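(* Let $l\ge1$ be an integer, $h$ a cusp form of weight two for $\Gamma_0(l)$, $i\in\mathbb{Z}/l\mathbb{Z}$, $k\ge3$ an integer, and $q=e^{2\pi i_0\tau}$ with $i_0=\sqrt{-1}$. Then $$E_{k,i;h}(\tau)=R_0+\sum_{m>0}R_mq^m,$$ where for $m>0$ $$R_m=\frac{(-2\pi i_0)^km^{k-1}}{(k-1)!}\sum_{c\in l\mathbb{Z}_{>0}}\ \sum_{\substack{d_0\in\mathbb{Z}/c\mathbb{Z}\\ \gcd(d_0,l)=1}}c^{-k}\Big(e^{-2\pi i_0\frac{d_0i}{l}}+(-1)^ke^{2\pi i_0\frac{d_0i}{l}}\Big)e^{2\pi i_0\left(m\frac{d_0}{c}+\mathrm{Re}\,H(-\frac{d_0}{c})\right)}$$ and $$R_0=\sum_{d\in\mathbb{Z},\,\gcd(d,l)=1}d^{-k}e^{-2\pi i_0\frac{di}{l}}.$$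
   Context: $\Gamma_0(l)$ is the group of matrices $\begin{pmatrix}a&b\\c&d\end{pmatrix}\in SL_2(\mathbb{Z})$ with $c\in l\mathbb{Z}$. For a cusp form $h$ of weight two for $\Gamma_0(l)$ put $H(\tau)=\int_{i\infty}^{\tau}h(s)\,ds$; then $H(\tau+1)=H(\tau)$. For $c\in l\mathbb{Z}$, $c\ne0$, $d\in\mathbb{Z}$, $\gcd(d,l)=1$, $H(-\frac dc)=\int_{i\infty}^{-d/c}h(s)\,ds$ (integral between cusps, convergent because $h$ is a cusp form); convention: $H(-\frac d0)=0$. The twisted Eisenstein series is $$E_{k,i;h}(\tau)=\sum_{c\in l\mathbb{Z}}\ \sum_{d\in\mathbb{Z},\,\gcd(l,d)=1}(c\tau+d)^{-k}e^{-2\pi i_0\frac{di}{l}}\,e^{2\pi i_0\,\mathrm{Re}\,H(-\frac dc)}.$$ The term $(c,d)=(0,0)$, and $d=0$ in $R_0$, are excluded (automatic for $l\ge2$). *)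

(* Defs.v *)
From HB Require Import structures.
From mathcomp Require Import all_boot all_order all_algebra complex.
From mathcomp Require Import all_classical all_reals all_analysis.
From mathcomp Require Import showcase.summability.

Set Implicit Arguments.
Unset Strict Implicit.
Unset Printing Implicit Defensive.

Import Order.TTheory GRing.Theory Num.Theory.
Import numFieldNormedType.Exports.

Local Open Scope classical_set_scope.
Local Open Scope complex_scope.
Local Open Scope ring_scope.

(* Conventions. The complex plane is [R[i]] for [R : realType]; its topology is
   the one carried by [R[i]^o], so [^o] is inserted only where a limit is taken.
   [x +i* y] is the complex number with parts [x] and [y], [x%:C] the embedding
   of the reals, and ['i%C] the imaginary unit. Functions on the upper
   half-plane are total functions [R[i] -> R[i]] whose values outside it are
   never used. *)

Section Sums.
Variable R : realType.

(* Unordered sums: the limit of the finite partial sums along the directed set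
   of finite subsets of the index type. In the complex plane convergence in this
   sense is the same as absolute convergence. *)
Definition usummable (I : choiceType) (x : I -> R[i]) : Prop :=
  cvg (partial_sum (x : I -> R[i]^o) @ totally).

Definition usum (I : choiceType) (x : I -> R[i]) : R[i] :=
  summability.sum (x : I -> R[i]^o).

(* [usum (extend0 P x)] is the sum of [x j] over the [j] satisfying [P]. *)
Definition extend0 (I : choiceType) (P : pred I) (x : I -> R[i]) : I -> R[i] :=
  fun j => if P j then x j else 0.

End Sums.

Section Exponential.
Variable R : realType.

Definition cexp (z : R[i]) : R[i] :=
  (expR (complex.Re z))%:C * (cos (complex.Im z) +i* sin (complex.Im z)).

Definition e2pi (z : R[i]) : R[i] := cexp ((2 * pi)%:C * 'i%C * z).

End Exponential.

Section CuspForms.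
Variable R : realType.

Definition SL2Z (g : 'M[int]_2) : Prop := \det g = 1.

Definition Gamma0 (l : nat) (g : 'M[int]_2) : Prop :=
  SL2Z g /\ (l%:Z %| g 1%R 0%R)%Z.

Definition autfactor (g : 'M[int]_2) (z : R[i]) : R[i] :=
  (g 1 0)%:~R * z + (g 1 1)%:~R.

Definition moebius (g : 'M[int]_2) (z : R[i]) : R[i] :=
  ((g 0 0)%:~R * z + (g 0 1)%:~R) / autfactor g z.

Definition slash (w : nat) (h : R[i] -> R[i]) (g : 'M[int]_2) (z : R[i]) : R[i] :=
  autfactor g z ^- w * h (moebius g z).

(* [derivable] over the field [R[i]] is complex differentiability. The last
   clause is vanishing at every cusp: each cusp is [g oo] for some [g] in
   SL_2(Z), and the expansion of [h|_w g] at [oo] has no terms of nonpositive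
   exponent iff [h|_w g] tends to 0 as the imaginary part goes to [oo]. *)
Record cusp_form (w l : nat) (h : R[i] -> R[i]) : Prop := CuspForm {
  cusp_form_holo : forall z : R[i], 0 < complex.Im z ->
    derivable (h : R[i]^o -> R[i]^o) z 1;
  cusp_form_mod : forall g : 'M[int]_2, Gamma0 l g ->
    forall z : R[i], 0 < complex.Im z -> slash w h g z = h z;
  cusp_form_cusps : forall g : 'M[int]_2, SL2Z g ->
    forall eps : R, 0 < eps -> exists M : R, forall z : R[i],
      0 < complex.Im z -> M < complex.Im z -> `|slash w h g z| < eps%:C
}.

Definition integralC (D : set R) (f : R -> R[i]) : R[i] :=
  (\int[lebesgue_measure]_(t in D) complex.Re (f t))
  +i* (\int[lebesgue_measure]_(t in D) complex.Im (f t)).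

(* The integral of [h] from [i oo] to [z] along the vertical line through [z]:
   with [s = Re z + i t], [ds = i dt] and [t] decreasing from [+oo] to [Im z],
   it is [- i] times the integral over [t > Im z]. It is also used at real [z],
   where it is the integral from [i oo] to a cusp. *)
Definition eichler (h : R[i] -> R[i]) (z : R[i]) : R[i] :=
  - 'i%C * integralC `]complex.Im z, +oo[ (fun t => h (complex.Re z +i* t)).

Definition eichler_cusp (h : R[i] -> R[i]) (c d : int) : R[i] :=
  if c == 0 then 0 else eichler h (- (d%:~R / c%:~R))%:C.

End CuspForms.

Section TwistedEisenstein.
Variable R : realType.
Implicit Types (l k m : nat) (i : int) (h : R[i] -> R[i]) (tau : R[i]).

(* The class [i] in Z/lZ is given by an arbitrary integer representative. *)
Definition twist l i (d : int) : R[i] := e2pi ((d * i)%:~R / l%:R).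

Definition eis_term l k i h tau : int * int -> R[i] :=
  extend0 (fun cd => [&& (l%:Z %| cd.1)%Z, coprimez cd.2 l%:Z & cd != (0, 0)])
    (fun cd => (cd.1%:~R * tau + cd.2%:~R) ^- k * twist l (- i) cd.2
               * e2pi (complex.Re (eichler_cusp h cd.1 cd.2))%:C).

Definition twisted_eisenstein l k i h tau : R[i] :=
  usum (eis_term l k i h tau).

Definition R0_term l k i : int -> R[i] :=
  extend0 (fun d => coprimez d l%:Z && (d != 0))
    (fun d => d%:~R ^- k * twist l (- i) d).

Definition R0 l k i : R[i] := usum (R0_term l k i).

(* Z/cZ is represented by 0, ..., c - 1; when [l] divides [c], neither the
   coprimality condition nor the summand depends on the representatives. *)
Definition Rm_term l k i h m : nat -> R[i] :=
  extend0 (fun c => (0 < c)%N && (l %| c)%N)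
    (fun c => \sum_(d < c | coprime d l)
       c%:R ^- k * (twist l (- i) d%:Z + (-1) ^+ k * twist l i d%:Z)
       * e2pi (m%:R * (d%:R / c%:R)
               + (complex.Re (eichler_cusp h c%:Z d%:Z))%:C)).

Definition Rm l k i h m : R[i] :=
  (- (2 * pi)%:C * 'i%C) ^+ k * m%:R ^+ k.-1 / (k.-1)`!%:R
  * usum (Rm_term l k i h m).

Definition qexp_term l k i h tau : nat -> R[i] :=
  extend0 (fun m => (0 < m)%N) (fun m => Rm l k i h m * e2pi tau ^+ m).

End TwistedEisenstein.

(* Main.v *)
Require Import Defs.
From HB Require Import structures.
From mathcomp Require Import all_boot all_order all_algebra complex.
From mathcomp Require Import finmap.
From mathcomp Require Import all_classical all_reals all_analysis.
From mathcomp Require Import showcase.summability.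
From mathcomp Require Import ring lra zify.

(** The proof expands each row of the double series by the Lipschitz formula
      sum_(n in Z) (tau + n)^-k
        = (-2 pi i)^k / (k-1)! * sum_(m > 0) m^(k-1) e(m tau),  e(z) = e^(2 pi i z),
    and exchanges the two remaining summations.

    Fix c > 0 divisible by l.  The translations in Gamma0(l) give
    h(z + n) = h(z), so that H(-d/c) depends only on d modulo c; the real
    part in the exponent makes its contribution a number of modulus one, and
    -(-d)/(-c) = -d/c.  So the rows c and -c of the Eisenstein series add up to
    sum_d (c tau + d)^-k v(d), where the weight v is bounded by 2 and periodic
    modulo c ([eis_term_pair], [pair_weight_periodic]).  Writing d = d0 + c n
    turns this into finitely many series
    c^-k v(d0) sum_n (tau + d0/c + n)^-k, and the Lipschitz formula at
    tau + d0/c produces the summand of index c of every R_m at once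
    ([lattice_row_expansion]).  The row c = 0 is R_0.  Everything converges
    absolutely: row c of the Eisenstein series is O(|c|^(1-k)) uniformly, and
    1 - k <= -2 ([lattice_summable]); the double family of the q-expansion is
    O(m^(k-1) |q|^m c^(1-k)).  Hence both Fubini exchanges are legitimate.

    The Lipschitz formula ([lipschitz_formula]) is obtained from an identity
    between a finite sum and a power series.  Expand (1 - x zeta)^-k in
    powers of x zeta and sum over the N-th roots of unity zeta: only exponents
    divisible by N survive.  With x = e(tau/N) this reads
      sum_(n mod N) (1 - e((tau + n)/N))^-k
        = N sum_(m >= 0) binomial(m N + k - 1, k - 1) e(m tau)
    ([has_sum_unity_roots]).  Divide by N^k and let N go to infinity: on the
    left N (1 - e((tau + n)/N)) tends to -2 pi i (tau + n), on the right
    binomial(m N + k - 1, k - 1) / N^(k-1) tends to m^(k-1) / (k-1)!.  Both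
    limits may be taken termwise by dominated convergence for series
    ([tends_has_sum]).  The left-hand bound
    |N (1 - e((tau + n)/N))| >= const (1 + |n|) for n in a centred system of
    residues modulo N is [normc_rescaled_ge]. *)

Set Implicit Arguments.
Unset Strict Implicit.
Unset Printing Implicit Defensive.

Import Order.TTheory GRing.Theory Num.Theory.
Import numFieldNormedType.Exports.
Import Normc.

Local Open Scope fset_scope.
Local Open Scope complex_scope.
Local Open Scope ring_scope.

Local Arguments normc : simpl never.

(** * The real-valued modulus *)

Section Modulus.
Variable R : realType.
Implicit Types (z w : R[i]) (a : R).

Lemma normc_normE z : `|z| = (normc z)%:C.
Proof. by rewrite normc_def; case: z. Qed.

Lemma normc_ge0 z : 0 <= normc z.
Proof. by rewrite -lecR -normc_normE normr_ge0. Qed.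

Lemma normc_real a : normc a%:C = `|a|.
Proof. by apply: complexI; rewrite -normc_normE normc_def /= expr0n addr0 sqrtr_sqr. Qed.

Lemma normcX z n : normc (z ^+ n) = normc z ^+ n.
Proof. by elim: n => [|n IH]; rewrite ?normc1 // !exprS normcM IH. Qed.

Lemma normc_nat n : normc (n%:R : R[i]) = n%:R.
Proof. by rewrite -(rmorph_nat (real_complex R)) normc_real ger0_norm. Qed.

Lemma normc_int n : normc (n%:~R : R[i]) = `|n%:~R|.
Proof. by rewrite -(rmorph_int (real_complex R)) normc_real. Qed.

Lemma normc_distC z w : normc (z - w) = normc (w - z).
Proof. by rewrite -normcN opprB. Qed.

Lemma normc_triB z w t : normc (z - w) <= normc (z - t) + normc (t - w).
Proof. by rewrite -[z - w](subrKA t); exact: le_normcD. Qed.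

Lemma normc_sum (I : Type) (s : seq I) (P : pred I) (x : I -> R[i]) :
  normc (\sum_(i <- s | P i) x i) <= \sum_(i <- s | P i) normc (x i).
Proof.
elim/big_ind2: _ => [|z a w b za wb|//]; first by rewrite normc0.
by apply: le_trans (le_normcD _ _) _; apply: lerD.
Qed.

Lemma abs_Re_normc z : `|complex.Re z| <= normc z.
Proof. by rewrite -lecR -normc_normE normc_ge_Re. Qed.

Lemma abs_Im_normc z : `|complex.Im z| <= normc z.
Proof.
have := abs_Re_normc (z * 'i%C); rewrite ReiNIm normrN normcM.
by rewrite /normc expr0n expr1n add0r sqrtr1 mulr1.
Qed.

Lemma normc_small z : (forall e, 0 < e -> normc z < e) -> z = 0.
Proof.
move=> zs; apply: eq0_normc; apply/eqP; rewrite eq_le normc_ge0 andbT.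
by apply/ler_addgt0Pl => e /zs /ltW; rewrite addr0.
Qed.

End Modulus.

(** * Unordered sums of complex families *)

Section HasSum.
Variable R : realType.
Implicit Types (I J : choiceType) (M e : R) (s : R[i]).

(** Convergence along finite subsets, phrased with the modulus [normc], whose
    values are real, so that estimates take place in a totally ordered field. *)
Definition has_sum I (x : I -> R[i]) s :=
  forall e, 0 < e -> exists A : {fset I}, forall B : {fset I}, A `<=` B ->
    normc (\sum_(i <- B) x i - s) < e.

Definition sums_le I (b : I -> R) M :=
  forall A : {fset I}, \sum_(i <- A) b i <= M.

(** A positive element of [R[i]] is a positive real, so real tolerances are
    enough for the topology of [R[i]]. *)
Lemma has_sum_cvg I (x : I -> R[i]) s : has_sum x s ->
  (partial_sum (x : I -> R[i]^o) @ totally --> (s : R[i]^o))%classic.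
Proof.
have totF := @totally_filter I.
move=> xs; apply/cvgrPdist_lt => e e0.
have [e1 eE] : exists e1, e = e1%:C.
  by exists (complex.Re e); rewrite RRe_real // gtr0_real.
move: e0; rewrite eE -[0]/(0%:C) ltcR => e10.
have [A AP] := xs _ e10.
exists A => // B /= AB; rewrite -normrN opprB normc_normE ltcR.
rewrite /partial_sum -(big_seq_fsetE _ B xpredT x); exact: AP.
Qed.

Lemma has_sum_usummable I (x : I -> R[i]) s : has_sum x s -> usummable x.
Proof. by move/has_sum_cvg => xs; apply/cvg_ex; exists s. Qed.

Lemma has_sum_usum I (x : I -> R[i]) s : has_sum x s -> usum x = s.
Proof.
have totF := @totally_filter I.
by move/has_sum_cvg => xs; apply: (cvg_lim _ xs).
Qed.

Lemma has_sum_unique I (x : I -> R[i]) s t :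
  has_sum x s -> has_sum x t -> s = t.
Proof. by move=> /has_sum_usum <- /has_sum_usum. Qed.

Lemma eq_has_sum I (x y : I -> R[i]) s :
  x =1 y -> has_sum x s -> has_sum y s.
Proof. by move=> /funext ->. Qed.

Lemma has_sum_fin (I : finType) (x : I -> R[i]) : has_sum x (\sum_i x i).
Proof.
move=> e e0; exists [fset i in I] => B /fsubsetP IB.
rewrite (_ : \sum_(i <- B) _ = \sum_i x i) ?subrr ?normc0 //.
rewrite -big_enum; apply: perm_big; rewrite uniq_perm ?enum_uniq // => i.
by rewrite mem_enum IB // inE.
Qed.

Lemma has_sum_single I (i : I) (x : I -> R[i]) :
  (forall j, j != i -> x j = 0) -> has_sum x (x i).
Proof.
move=> x0 e e0; exists [fset i] => B; rewrite fsub1set => iB.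
rewrite (big_fsetD1 i) //= addrAC subrr add0r big1_fset ?normc0 // => j.
by rewrite !inE => /andP[ji _] _; exact: x0.
Qed.

Lemma has_sum0 I : has_sum (fun _ : I => 0) 0.
Proof. by move=> e e0; exists fset0 => B _; rewrite big1 // subrr normc0. Qed.

Lemma has_sumD I (x y : I -> R[i]) s t :
  has_sum x s -> has_sum y t -> has_sum (fun i => x i + y i) (s + t).
Proof.
move=> xs yt e e0; have e20 : 0 < e / 2 by lra.
have [A AP] := xs _ e20; have [A' AP'] := yt _ e20.
exists (A `|` A') => B; rewrite fsubUset => /andP[/AP + /AP'].
rewrite big_split opprD addrACA => ha hb.
by apply: le_lt_trans (le_normcD _ _) _; lra.
Qed.

Lemma has_sumZ I (x : I -> R[i]) s a :
  has_sum x s -> has_sum (fun i => a * x i) (a * s).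
Proof.
move=> xs e e0; have a0 := normc_ge0 a.
have [|A AP] := xs (e / (normc a + 1)); first by apply: divr_gt0 => //; lra.
exists A => B /AP; rewrite -mulr_sumr -mulrBr normcM ltr_pdivlMr; last by lra.
by have := normc_ge0 (\sum_(i <- B) x i - s); nra.
Qed.

Lemma has_sumN I (x : I -> R[i]) s :
  has_sum x s -> has_sum (fun i => - x i) (- s).
Proof.
by move/(has_sumZ (-1)); rewrite mulN1r; apply: eq_has_sum => i; rewrite mulN1r.
Qed.

Lemma has_sum_sum I J (r : seq J) (P : pred J) (x : J -> I -> R[i])
    (s : J -> R[i]) :
  (forall j, P j -> has_sum (x j) (s j)) ->
  has_sum (fun i => \sum_(j <- r | P j) x j i) (\sum_(j <- r | P j) s j).
Proof.
move=> xs; elim: r => [|j r IH].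
  by rewrite big_nil; apply: eq_has_sum (has_sum0 _) => i; rewrite big_nil.
rewrite big_cons; case: ifP => Pj.
  apply: eq_has_sum (has_sumD (xs _ Pj) IH) => i.
  by rewrite big_cons Pj.
by apply: eq_has_sum IH => i; rewrite big_cons Pj.
Qed.

Lemma normc_has_sum_le I (x : I -> R[i]) s M (A : {fset I}) : has_sum x s ->
  (forall B, A `<=` B -> normc (\sum_(i <- B) x i) <= M) -> normc s <= M.
Proof.
move=> xs xM; apply/ler_addgt0Pl => e e0; have [A' AP] := xs _ e0.
have := AP (A `|` A') (fsubsetUr _ _); have := xM (A `|` A') (fsubsetUl _ _).
set S := \sum_(i <- _) _ => h1 h2.
have := normc_triB s 0 S; rewrite !subr0 normc_distC; lra.
Qed.

Lemma sum_fsetD (V : nmodType) I (A B : {fset I}) (x : I -> V) : A `<=` B ->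
  \sum_(i <- B) x i = \sum_(i <- A) x i + \sum_(i <- B `\` A) x i.
Proof.
move=> AB; rewrite (big_fsetID _ (mem A)) /=; congr (_ + _);
  apply: eq_fbigl => i; rewrite !inE /= 1?andbC //.
by case: (boolP (i \in A)) => //= iA; rewrite (fsubsetP AB).
Qed.

Lemma le_sum_fset I (A B : {fset I}) (b : I -> R) : (forall i, 0 <= b i) ->
  A `<=` B -> \sum_(i <- A) b i <= \sum_(i <- B) b i.
Proof.
by move=> b0 AB; rewrite (sum_fsetD _ AB) lerDl sumr_ge0.
Qed.

Lemma sums_le_le I (b c : I -> R) M :
  (forall i, b i <= c i) -> sums_le c M -> sums_le b M.
Proof. by move=> bc cM A; apply: le_trans (cM A); apply: ler_sum. Qed.

Lemma sums_le_trans I (b : I -> R) M N :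
  sums_le b M -> M <= N -> sums_le b N.
Proof. by move=> bM MN A; apply: le_trans (bM A) MN. Qed.

Lemma sums_leZ I (b : I -> R) M a :
  0 <= a -> sums_le b M -> sums_le (fun i => a * b i) (a * M).
Proof. by move=> a0 bM A; rewrite -mulr_sumr ler_wpM2l. Qed.

Lemma sums_leD I (b c : I -> R) M N :
  sums_le b M -> sums_le c N -> sums_le (fun i => b i + c i) (M + N).
Proof. by move=> bM cN A; rewrite big_split lerD. Qed.

Lemma sums_le_fin (I : finType) (b : I -> R) :
  (forall i, 0 <= b i) -> sums_le b (\sum_i b i).
Proof.
move=> b0 A; apply: le_trans (le_sum_fset b0 (_ : A `<=` [fset i in I])) _.
  by apply/fsubsetP => i _; rewrite inE.
rewrite -[leRHS]big_enum le_eqVlt; apply/orP; left; apply/eqP/perm_big.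
by rewrite uniq_perm ?enum_uniq // => i; rewrite mem_enum !inE.
Qed.

Lemma sums_le_sup I (b : I -> R) M : (forall i, 0 <= b i) -> sums_le b M ->
  exists S, sums_le b S /\
    forall e, 0 < e -> exists A : {fset I}, S - e < \sum_(i <- A) b i.
Proof.
move=> b0 bM; pose E := [set r | exists A : {fset I}, r = \sum_(i <- A) b i]%classic.
have supE : has_sup E.
  split; first by exists 0, fset0; rewrite big_seq_fset0.
  by exists M => _ [A ->].
exists (sup E); split => [A|e e0].
  by apply: (sup_upper_bound supE); exists A.
by have [_ [A ->]] := sup_adherent e0 supE; exists A.
Qed.

Lemma has_sum_nonneg I (b : I -> R) M : (forall i, 0 <= b i) -> sums_le b M ->
  exists s, has_sum (fun i => (b i)%:C) s.
Proof.
move=> b0 bM; have [S [bS adh]] := sums_le_sup b0 bM.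
exists S%:C => e /adh [A AS]; exists A => B AB.
rewrite -rmorph_sum -rmorphB normc_real distrC ger0_norm ?subr_ge0 //.
by have := le_sum_fset b0 AB; lra.
Qed.

(** Monotone bounded nets of reals converge to their supremum.  A real family
    [b] is the difference of the nonnegative families [|b| + b] and [|b|], and
    a complex family is split into its real and imaginary parts. *)
Lemma abs_has_sum I (x : I -> R[i]) M : sums_le (fun i => normc (x i)) M ->
  exists s, has_sum x s.
Proof.
move=> xM.
have real_case (b : I -> R) : (forall i, `|b i| <= normc (x i)) ->
    exists s, has_sum (fun i => (b i)%:C) s.
  move=> bx; have := xM; move/(sums_le_le bx) => babs.
  have [s bs] := has_sum_nonneg (fun i => normr_ge0 (b i)) babs.
  have [i||t bt] := @has_sum_nonneg _ (fun i => `|b i| + b i) (M + M).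
  - by have := ler_norm (- b i); rewrite normrN; lra.
  - by apply: sums_leD => //; apply: sums_le_le babs => i; exact: ler_norm.
  exists (t - s); apply: eq_has_sum (has_sumD bt (has_sumN bs)) => i.
  by rewrite -rmorphB /= addrC addKr.
have [s sP] := real_case _ (fun i => abs_Re_normc (x i)).
have [t tP] := real_case _ (fun i => abs_Im_normc (x i)).
exists (s + 'i%C * t); apply: eq_has_sum (has_sumD sP (has_sumZ 'i%C tP)) => i.
by rewrite -complexE.
Qed.

(** Reindexing along an injection [f] whose image contains the support; the
    partial inverse [g] makes preimages of finite sets computable. *)
Section Reindex.
Variables (I J : choiceType) (f : I -> J) (g : J -> option I).
Hypotheses (fK : pcancel f g) (gK : ocancel g f).

Let pre (B : {fset J}) : {fset I} := [fset i in pmap g B].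

Let mem_pre B i : (i \in pre B) = (f i \in B).
Proof.
rewrite !inE mem_pmap; apply/mapP/idP => [[j jB ij]|fiB]; last by exists (f i).
by have := gK j; rewrite -ij /= => ->.
Qed.

Let sum_pre (V : nmodType) (x : J -> V) (B : {fset J}) :
  (forall j, g j = None -> x j = 0) ->
  \sum_(j <- B) x j = \sum_(i <- pre B) x (f i).
Proof.
move=> x0; have -> : \sum_(i <- pre B) x (f i) = \sum_(i <- pmap g B) x (f i).
  by apply: perm_big; rewrite uniq_perm ?(pmap_uniq gK) // => i; rewrite !inE.
rewrite big_pmap; apply: eq_bigr => j _.
by case E: (g j) => [i|] /=; [have := gK j; rewrite E /= => -> | exact: x0].
Qed.

Lemma has_sum_reindex (x : J -> R[i]) s : (forall j, g j = None -> x j = 0) ->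
  has_sum (x \o f) s <-> has_sum x s.
Proof.
move=> x0; split=> xs e /xs [A AP].
  exists (f @` A) => B AB; rewrite sum_pre //; apply: AP.
  by apply/fsubsetP => i iA; rewrite mem_pre (fsubsetP AB) ?in_imfset.
exists (pre A) => B AB; have := AP (A `|` f @` B) (fsubsetUl _ _).
rewrite sum_pre //; congr (normc (_ - _) < _); apply: eq_fbigl => i.
rewrite mem_pre inE; apply/idP/idP => [|iB]; last by rewrite in_imfset ?orbT.
case/orP => [fiA|/imfsetP[j /= jB /(pcan_inj fK) ->] //].
by rewrite (fsubsetP AB) // mem_pre.
Qed.

End Reindex.

Lemma sums_le_inj I J (f : I -> J) (b : J -> R) M : injective f ->
  (forall j, 0 <= b j) -> sums_le b M -> sums_le (b \o f) M.
Proof.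
move=> fI b0 bM A; apply: le_trans (bM (f @` A)).
by rewrite big_imfset //= => i j _ _; exact: fI.
Qed.

Lemma has_sum_bij I J (f : I -> J) (g : J -> I) (x : J -> R[i]) s :
  cancel f g -> cancel g f -> has_sum (x \o f) s <-> has_sum x s.
Proof.
by move=> fK gK; apply: (@has_sum_reindex _ _ f (Some \o g)) => // i /=; rewrite fK.
Qed.

Lemma has_sum_succ (x : nat -> R[i]) s : x 0%N = 0 ->
  has_sum (fun n => x n.+1) s <-> has_sum x s.
Proof.
move=> x0.
apply: (@has_sum_reindex _ _ S (fun n => if n is n'.+1 then Some n' else None)).
- by [].
- by case.
- by case.
Qed.

Lemma sum_rect (V : nmodType) I J (A : {fset I}) (B : {fset J})
    (x : I * J -> V) :
  \sum_(p <- A `*` B) x p = \sum_(i <- A) \sum_(j <- B) x (i, j).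
Proof.
rewrite (@pair_big_dep_cond _ _ _ _ _ A (fun=> B) xpredT (fun=> xpredT)
  (fun i j => x (i, j))).
rewrite [RHS](eq_bigr x) => [|[] //]; apply: eq_fbigl => -[i j].
rewrite in_fsetM; apply/andP/imfset2P => /= [[iA jB]|[i' + [j' + [-> ->]]]].
  by exists i; [|exists j]; rewrite ?inE ?iA ?jB.
by rewrite !inE !andbT.
Qed.

(** A sum over [I * J] may be evaluated row by row as soon as the rows have
    sums: over a finite set [B] of rows containing the projection of a large
    finite set, the row sums are approximated simultaneously by the rectangle
    [B * D'], whose sum is already close to [s]. *)
Lemma has_sum_fubini I J (x : I * J -> R[i]) (y : I -> R[i]) s :
  has_sum x s -> (forall i, has_sum (fun j => x (i, j)) (y i)) -> has_sum y s.
Proof.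
move=> xs xy e e0; have e20 : 0 < e / 2 by lra.
have [A AP] := xs _ e20; exists [fset p.1 | p in A] => B AB.
pose d := e / 2 / #|` B|.+1%:R; have d0 : 0 < d by rewrite divr_gt0.
have [D DP] : exists D : {fset J}, forall D', D `<=` D' ->
    forall i, i \in (B : seq I) -> normc (\sum_(j <- D') x (i, j) - y i) < d.
  elim: (B : seq I) => [|i r [D DP]]; first by exists fset0.
  have [D1 D1P] := xy i _ d0; exists (D `|` D1) => D'.
  rewrite fsubUset => /andP[/DP D'1 /D1P D'2] i'.
  by rewrite in_cons => /predU1P[->//|/D'1].
pose D' := D `|` [fset p.2 | p in A].
have /AP : A `<=` B `*` D'.
  apply/fsubsetP => p pA; rewrite in_fsetM.
  rewrite (fsubsetP AB) ?in_imfset //=.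
  by rewrite inE in_imfset ?orbT.
rewrite sum_rect => h1.
set S := \sum_(i <- B) _ in h1.
apply: le_lt_trans (normc_triB _ _ S) _; rewrite [ltRHS]splitr.
apply: ler_ltD h1; rewrite /S -sumrB; apply: le_trans (normc_sum _ _ _) _.
apply: (@le_trans _ _ (\sum_(i <- B) d)).
  rewrite big_seq [leRHS]big_seq; apply: ler_sum => i iB; rewrite normc_distC; apply/ltW/DP => //.
  exact: fsubsetUl.
rewrite big_const_seq count_predT iter_addr_0 -[leLHS]mulr_natr /d.
rewrite -mulrA ler_piMr ?(ltW e20) //.
by rewrite mulrC ler_pdivrMr // mul1r ler_nat leqnSn.
Qed.

(** The family is a finite sum of families, each supported on one row. *)
Lemma has_sum_finprod (I : finType) (J : choiceType) (x : I * J -> R[i])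
    (y : I -> R[i]) :
  (forall a, has_sum (fun j => x (a, j)) (y a)) -> has_sum x (\sum_a y a).
Proof.
move=> xy.
have := @has_sum_sum (I * J)%type I (index_enum I) xpredT
  (fun a p => if p.1 == a then x p else 0) y.
move=> H; apply: eq_has_sum (H _) => [p|a _].
  by rewrite -big_mkcond (big_pred1 p.1) // => a; rewrite eq_sym.
apply/(has_sum_reindex (f := fun j => (a, j))
    (g := fun p => if p.1 == a then Some p.2 else None)).
- by move=> j /=; rewrite eqxx.
- by case=> b j /=; case: eqP => //= ->.
- by move=> p; case: eqP.
- by apply: eq_has_sum (xy a) => j /=; rewrite eqxx.
Qed.

(** Away from 0 the integers are pairs of a natural number and a sign; the
    two signs are then summed first. *)
Lemma has_sum_int_pairs (y : int -> R[i]) s : has_sum y s ->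
  has_sum (fun n : nat => y n.+1%:Z + y (- n.+1%:Z)) (s - y 0).
Proof.
move=> ys.
pose f (p : nat * bool) : int := if p.2 then p.1.+1%:Z else - p.1.+1%:Z.
pose g (n : int) : option (nat * bool) :=
  match n with Posz 0 => None | Posz n.+1 => Some (n, true)
  | Negz n => Some (n, false) end.
pose y' (n : int) := if n == 0 then 0 else y n.
have y's : has_sum y' (s - y 0).
  have y0 := @has_sum_single int 0 (fun n => if n == 0 then - y 0 else 0) _.
  have {y0}/= y0 : has_sum (fun n : int => if n == 0 then - y 0 else 0) (- y 0).
    by apply: y0 => j /negPf ->.
  apply: eq_has_sum (has_sumD ys y0) => n; rewrite /y'.
  by case: eqP => [->|_]; rewrite ?subrr ?addr0.
have y'f : has_sum (y' \o f) (s - y 0).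
  apply/(has_sum_reindex (g := g)) => //; rewrite /f /g.
  - by case=> n [].
  - by case=> [[|n]|n] //=; rewrite NegzE.
  - by case=> [[|n]|n].
apply: has_sum_fubini y'f _ => n.
have := @has_sum_fin bool (fun b => y' (f (n, b))).
by rewrite big_bool.
Qed.

Lemma sums_le_prod I J (b : I * J -> R) (c : I -> R) M :
  (forall p, 0 <= b p) -> (forall i, sums_le (fun j => b (i, j)) (c i)) ->
  sums_le c M -> sums_le b M.
Proof.
move=> b0 bc cM A.
have AB : A `<=` [fset p.1 | p in A] `*` [fset p.2 | p in A].
  by apply/fsubsetP => p pA; rewrite in_fsetM !in_imfset.
apply: le_trans (le_sum_fset b0 AB) _; rewrite sum_rect.
by apply: le_trans (cM [fset p.1 | p in A]); apply: ler_sum => i _; exact: bc.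
Qed.

End HasSum.

(** * Reference series *)

Section RealBounds.
Variable R : realType.

Lemma sums_le_nat (b : nat -> R) M : (forall j, 0 <= b j) ->
  (forall n, \sum_(j < n) b j <= M) -> sums_le b M.
Proof.
move=> b0 bM A.
have [n nP] : exists n, forall j, j \in A -> (j < n)%N.
  by exists (\max_(j <- A) j).+1 => j jA; rewrite ltnS (big_rem j) //= leq_maxl.
apply: le_trans (bM n); rewrite -(big_mkord xpredT b).
have An : A `<=` [fset j in index_iota 0 n].
  by apply/fsubsetP => j jA; rewrite !inE mem_index_iota /= nP.
apply: le_trans (le_sum_fset b0 An) _.
rewrite le_eqVlt; apply/orP; left; apply/eqP/perm_big.
by apply: uniq_perm; rewrite ?iota_uniq // => j; rewrite !inE.
Qed.

(** The partial sums of 1/n^2 are at most 2 - 1/n, since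
    1/t - 1/(t+1) >= 1/(t+1)^2. *)
Lemma sums_le_inv_sqr : sums_le (fun n : nat => (n.+1%:R ^- 2 : R)) 2.
Proof.
apply: sums_le_nat => [j|n]; first by rewrite invr_ge0 exprn_ge0.
case: n => [|n]; first by rewrite big_ord0.
apply: (@le_trans _ _ (2 - n.+1%:R^-1)); last by rewrite gerBl invr_ge0.
elim: n => [|n IH]; first by rewrite big_ord1 invr1 expr1n invr1; lra.
rewrite big_ord_recr /=; apply: le_trans (lerD IH (lexx _)) _.
rewrite -[n.+2]addn1 natrD; set t := n.+1%:R.
have t1 : 1 <= t by rewrite /t ler1n.
rewrite -subr_ge0.
have -> : 2 - (t + 1)^-1 - (2 - t^-1 + (t + 1) ^- 2)
  = (t * (t + 1) ^+ 2)^-1.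
  by field; rewrite !gt_eqF //; lra.
by rewrite invr_ge0 mulr_ge0 ?sqr_ge0 //; lra.
Qed.

Lemma sums_le_int : sums_le (fun n : int => ((1 + `|n%:~R|) ^- 2 : R)) 4.
Proof.
pose b (p : bool * nat) : R := p.2.+1%:R ^- 2.
have b0 p : 0 <= b p by rewrite invr_ge0 exprn_ge0.
have bM : sums_le b 4.
  apply: (@sums_le_prod _ _ _ _ (fun=> 2)) => // [i|].
    exact: sums_le_inv_sqr.
  have := @sums_le_fin R bool (fun=> 2) (fun=> ler0n _ _).
  by rewrite big_bool /= -natrD.
pose f n : bool * nat :=
  match n with Posz j => (true, j) | Negz j => (false, j) end.
have fI : injective f by case=> [] n [] m //= [->].
apply: sums_le_le (sums_le_inj fI b0 bM) => -[] n; rewrite /b /=.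
  by rewrite -natr1 addrC ger0_norm.
rewrite NegzE rmorphN normrN /= ger0_norm //.
have n1 : 0 < n.+1%:R :> R by [].
rewrite lef_pV2 ?posrE ?exprn_gt0 ?addr_gt0 //.
by rewrite lerXn2r ?nnegrE ?addr_ge0 // lerDr.
Qed.

End RealBounds.

Section BinomialSeries.
Variable R : realType.

(** Multiplying a partial sum of order [K.+1] by [1 - r] gives, by Pascal's rule,
    a partial sum of order [K] minus a nonnegative boundary term. *)
Lemma sums_le_binomial (r : R) K : 0 <= r < 1 ->
  sums_le (fun j : nat => 'C(j + K, K)%:R * r ^+ j) ((1 - r) ^- K.+1).
Proof.
move=> /andP[r0 r1]; apply: sums_le_nat => [j|n].
  by rewrite mulr_ge0 ?exprn_ge0.
have r10 : 0 < 1 - r by lra.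
elim: K n => [|K IH] n.
  rewrite expr1 -[leRHS]mul1r ler_pdivlMr // mulrC.
  have -> : \sum_(j < n) 'C(j + 0, 0)%:R * r ^+ j = \sum_(j < n) r ^+ j.
    by apply: eq_bigr => j _; rewrite bin0 mul1r.
  by rewrite -opprB mulNr -subrX1 opprB gerBl exprn_ge0.
rewrite exprSr invfM ler_pdivlMr // mulrC; apply: le_trans (IH n).
have -> : (1 - r) * \sum_(j < n) 'C(j + K.+1, K.+1)%:R * r ^+ j
    = \sum_(j < n) 'C(j + K, K)%:R * r ^+ j - 'C(n + K, K.+1)%:R * r ^+ n.
  elim: n => [|n IHn]; first by rewrite !big_ord0 add0n bin_small // mul0r subrr mulr0.
  rewrite !big_ord_recr /= mulrDr {}IHn addnS addSn binS natrD exprS.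
  ring.
by rewrite gerBl mulr_ge0 ?exprn_ge0.
Qed.

(** By Pascal's rule the family of order [K] is the family [a] of order [K.+1]
    minus [x] times its shift, so that [1 - x] times the sum of [a] is known. *)
Lemma has_sum_binomial (x : R[i]) K : normc x < 1 ->
  has_sum (fun j : nat => 'C(j + K, K)%:R * x ^+ j) ((1 - x) ^- K.+1).
Proof.
move=> x1; have x10 : 1 - x != 0.
  by apply: contraTneq x1 => /eqP; rewrite subr_eq0 => /eqP <-; rewrite normc1 ltxx.
pose a K j : R[i] := 'C(j + K, K)%:R * x ^+ j.
have summable K' : exists s, has_sum (a K') s.
  apply: (@abs_has_sum _ _ _ ((1 - normc x) ^- K'.+1)).
  apply: sums_le_le (sums_le_binomial K' _) => [j|].
    by rewrite normcM normc_nat normcX.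
  by rewrite normc_ge0.
have shift K' s : has_sum (a K') s ->
    has_sum (fun j => a K' j - (if j is j'.+1 then x * a K' j' else 0))
      ((1 - x) * s).
  move=> as_; rewrite mulrBl mul1r; apply: has_sumD (as_) (has_sumN _).
  apply/(has_sum_succ (x := fun j => if j is j'.+1 then x * a K' j' else 0)) => //.
  exact: has_sumZ as_.
elim: K => [|K IH].
  have [s as_] := summable 0%N; rewrite expr1.
  have -> : (1 - x)^-1 = s; last by [].
  apply: (mulfI x10); rewrite divff //.
  have one := @has_sum_single R nat 0%N (fun j => (j == 0%N)%:R) _.
  have {one}one : has_sum (fun j => (j == 0%N)%:R : R[i]) 1.
    by apply: one => j /negPf ->.
  apply: has_sum_unique one _; apply: eq_has_sum (shift _ _ as_) => -[|j].
    by rewrite /a subr0 mul1r.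
  by rewrite /a !bin0 !mul1r exprS subrr.
have [s as_] := summable K.+1.
have -> : (1 - x) ^- K.+2 = s; last by [].
apply: (mulfI x10); rewrite exprS invfM mulrA divff // mul1r.
apply: has_sum_unique IH _; apply: eq_has_sum (shift _ _ as_) => -[|j].
  by rewrite /a subr0 !add0n !binn.
rewrite /a addSn binS natrD addSnnS exprS; ring.
Qed.

End BinomialSeries.

(** * Limits of complex sequences *)

Section Limits.
Variable R : realType.
Implicit Types (u v : nat -> R[i]) (f : R -> R) (e : R).

Definition tends (u : nat -> R[i]) (l : R[i]) :=
  forall e, 0 < e -> exists N, forall n, (N <= n)%N -> normc (u n - l) < e.

Lemma tends_unique u l l' : tends u l -> tends u l' -> l = l'.
Proof.
move=> ul ul'; apply/eqP; rewrite -subr_eq0; apply/eqP/normc_small => e e0.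
have e20 : 0 < e / 2 by lra.
have [N NP] := ul _ e20; have [N' NP'] := ul' _ e20.
have := NP _ (leq_maxl N N'); have := NP' _ (leq_maxr N N').
set n := maxn N N'; have := normc_triB l l' (u n).
by rewrite (normc_distC l (u n)); lra.
Qed.

Lemma tendsP u (l : R[i]) :
  tends u l <-> ((u : nat -> R[i]^o) @ \oo --> (l : R[i]^o))%classic.
Proof.
split=> [ul|/cvgrPdist_lt ul e e0].
  apply/cvgrPdist_lt => e e0.
  have [e1 eE] : exists e1, e = e1%:C.
    by exists (complex.Re e); rewrite RRe_real // gtr0_real.
  move: e0; rewrite eE -[0]/(0%:C) ltcR => /ul[N NP].
  exists N => // n /= Nn; rewrite -normrN opprB normc_normE ltcR; exact: NP.
have /ul[N _ NP] : 0 < e%:C by rewrite -[0]/(0%:C) ltcR.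
exists N => n /NP /=; rewrite -normrN opprB normc_normE ltcR //.
Qed.

Lemma tendsD u v (l m : R[i]) :
  tends u l -> tends v m -> tends (fun n => u n + v n) (l + m).
Proof. by move=> /tendsP ul /tendsP vm; apply/tendsP; exact: cvgD. Qed.

Lemma tendsM u v (l m : R[i]) :
  tends u l -> tends v m -> tends (fun n => u n * v n) (l * m).
Proof.
move=> /tendsP ul /tendsP vm; apply/tendsP.
exact: (@cvgM R[i] _ _ _ u v l m ul vm).
Qed.

Lemma tendsV u (l : R[i]) : l != 0 -> tends u l -> tends (fun n => (u n)^-1) l^-1.
Proof. move=> l0 /tendsP ul; apply/tendsP; exact: (@cvgV R[i] _ _ _ u l l0 ul). Qed.

Lemma tends_cst (l : R[i]) : tends (fun=> l) l.
Proof. by move=> e e0; exists 0%N => n _; rewrite subrr normc0. Qed.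

Lemma tends_near_eq u v (l : R[i]) N0 :
  (forall n, (N0 <= n)%N -> u n = v n) -> tends u l -> tends v l.
Proof.
move=> uv ul e /ul[N NP]; exists (maxn N N0) => n.
by rewrite geq_max => /andP[/NP + /uv <-].
Qed.

Lemma tendsX u (l : R[i]) k : tends u l -> tends (fun n => u n ^+ k) (l ^+ k).
Proof.
move=> ul; elim: k => [|k IH]; first exact: tends_cst.
rewrite exprS; apply: (tends_near_eq (N0 := 0%N)) (tendsM ul IH) => n _.
by rewrite exprS.
Qed.

Lemma tends_prod (I : Type) (r : seq I) (u : I -> nat -> R[i]) (l : I -> R[i]) :
  (forall i, tends (u i) (l i)) ->
  tends (fun n => \prod_(i <- r) u i n) (\prod_(i <- r) l i).
Proof.
move=> ul; elim: r => [|i r IH].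
  apply: (tends_near_eq (N0 := 0%N)) (tends_cst _) => n _.
  by rewrite !big_nil.
rewrite big_cons; apply: (tends_near_eq (N0 := 0%N)) (tendsM (ul i) IH).
by move=> n _; rewrite big_cons.
Qed.

Lemma tends_inv_nat : tends (fun n => (n.+1%:R : R[i])^-1) 0.
Proof.
move=> e e0; have /cvgrPdist_lt/(_ e e0)[N _ NP] := @cvg_harmonic R.
exists N => n /NP; rewrite /harmonic /= sub0r normrN subr0.
by rewrite normcV normc_nat ger0_norm ?invr_ge0.
Qed.

Lemma tends_diffquot f d : is_derive (0 : R) 1 f d ->
  tends (fun n => (n.+1%:R * (f n.+1%:R^-1 - f 0))%:C) d%:C.
Proof.
case; rewrite /derivable /derive => cf limf e e0.
have {cf}: (h^-1 *: ((f \o shift 0) (h *: (1 : R)) - f 0)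
    @[h --> (0 : R)^'] --> d)%classic by rewrite -limf.
move=> /cvgrPdist_lt/(_ e e0).
case=> /= del del0 delP.
have /cvgrPdist_lt/(_ del del0)[N _ NP] := @cvg_harmonic R.
exists N => n /NP ndel.
rewrite -(rmorphB (real_complex R)) normc_real.
have := delP n.+1%:R^-1 ndel; rewrite invr_eq0 pnatr_eq0 => /(_ isT).
rewrite distrC invrK /= addr0 /GRing.scale /= mulr1 //.
Qed.

Lemma tends_comp u (l : R[i]) (p : nat -> nat) :
  (forall n, (n <= p n)%N) -> tends u l -> tends (u \o p) l.
Proof.
by move=> np ul e /ul[N NP]; exists N => n Nn; apply/NP/(leq_trans Nn).
Qed.

(** Dominated convergence for series: up to [e / 4] the majorant [b] is carried
    by a finite set [A], on which convergence is uniform, and off [A] both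
    families are bounded by the tail of [b]. *)
Lemma tends_has_sum (I : choiceType) (x : nat -> I -> R[i]) (x' : I -> R[i])
    (s : nat -> R[i]) (b : I -> R) M N0 :
  (forall n, has_sum (x n) (s n)) ->
  (forall i, tends (x ^~ i) (x' i)) ->
  (forall n i, (N0 <= n)%N -> normc (x n i) <= b i) -> sums_le b M ->
  exists s', has_sum x' s' /\ tends s s'.
Proof.
move=> xs xx' xb bM.
have b0 i : 0 <= b i by apply: le_trans (xb N0 i _); rewrite ?normc_ge0.
have x'b i : normc (x' i) <= b i.
  apply/ler_addgt0Pl => d d0; have [N NP] := xx' i _ d0.
  have := NP _ (leq_maxl N N0); have := xb _ i (leq_maxr N N0).
  have := normc_triB (x' i) 0 (x (maxn N N0) i).
  by rewrite !subr0 normc_distC; lra.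
have [s' xs'] := abs_has_sum (sums_le_le x'b bM).
exists s'; split => // e e0.
have [S [bS adh]] := sums_le_sup b0 bM.
have [|A AS] := adh (e / 4); first by lra.
pose d := e / 4 / #|` A|.+1%:R; have d0 : 0 < d by rewrite divr_gt0 //; lra.
have [N NP] : exists N, forall n, (N <= n)%N ->
    forall i, i \in (A : seq I) -> normc (x n i - x' i) < d.
  elim: (A : seq I) => [|i r [N NP]]; first by exists 0%N.
  have [N1 N1P] := xx' i _ d0; exists (maxn N N1) => n.
  rewrite geq_max => /andP[/NP Nn /N1P N1n] i'.
  by rewrite in_cons => /predU1P[->//|/Nn].
exists (maxn N N0) => n; rewrite geq_max => /andP[Nn N0n].
(* [e / 4] for the indices in [A], and twice the tail of [b] for the others. *)
apply: (@le_lt_trans _ _ (e / 4 + 2 * (e / 4))); last by lra.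
apply: (normc_has_sum_le (A := A) (has_sumD (xs n) (has_sumN xs'))) => B AB.
rewrite (sum_fsetD _ AB); apply: le_trans (le_normcD _ _) _; apply: lerD.
  apply: le_trans (normc_sum _ _ _) _.
  apply: (@le_trans _ _ (\sum_(i <- A) d)).
    by rewrite big_seq [leRHS]big_seq; apply: ler_sum => i iA; apply/ltW/NP.
  rewrite big_const_seq count_predT iter_addr_0 -[leLHS]mulr_natr /d.
  rewrite -mulrA ler_piMr //; first by lra.
  by rewrite mulrC ler_pdivrMr // mul1r ler_nat leqnSn.
apply: le_trans (normc_sum _ _ _) _.
apply: (@le_trans _ _ (2 * \sum_(i <- B `\` A) b i)).
  rewrite mulr_sumr; apply: ler_sum => i _.
  apply: le_trans (le_normcD _ _) _; rewrite normcN.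
  by have := xb _ i N0n; have := x'b i; lra.
have := bS B; rewrite (sum_fsetD _ AB); lra.
Qed.

End Limits.

(** * The exponential e(z) and roots of unity *)

Section Exponential.
Variable R : realType.
Implicit Types (z w : R[i]) (x y : R).

Lemma e2piE x y : e2pi (x +i* y) =
  (expR (- (2 * pi * y)))%:C * (cos (2 * pi * x) +i* sin (2 * pi * x)).
Proof.
rewrite /e2pi /cexp.
have -> : (2 * pi : R)%:C * 'i%C * (x +i* y) = (- (2 * pi * y)) +i* (2 * pi * x).
  by apply/eqP; rewrite eq_complex /=; apply/andP; split; apply/eqP; ring.
by [].
Qed.

Lemma e2piD z w : e2pi (z + w) = e2pi z * e2pi w.
Proof.
case: z w => [x y] [u v]; rewrite /= -[_ + _]/((x + u) +i* (y + v)) !e2piE.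
rewrite !mulrDr opprD expRD cosD sinD rmorphM /=.
by apply/eqP; rewrite eq_complex /=; apply/andP; split; apply/eqP; ring.
Qed.

Lemma e2pi0 : e2pi 0 = 1 :> R[i].
Proof.
rewrite -[0]/(0 +i* 0) e2piE !mulr0 oppr0 expR0 cos0 sin0.
by rewrite mul1r.
Qed.

Lemma e2piN z : e2pi (- z) = (e2pi z)^-1.
Proof.
have := e2piD z (- z); rewrite subrr e2pi0 => zN.
have z0 : e2pi z != 0.
  by apply: contra_eq_neq zN => ->; rewrite mul0r oner_neq0.
by apply: (mulfI z0); rewrite -zN divff.
Qed.

Lemma e2piM_natr z n : e2pi (z * n%:R) = e2pi z ^+ n.
Proof.
elim: n => [|n IH]; first by rewrite mulr0 e2pi0.
by rewrite -natr1 mulrDr mulr1 e2piD IH exprSr.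
Qed.

Lemma e2pi_int (n : int) : e2pi n%:~R = 1 :> R[i].
Proof.
have one : e2pi 1 = 1 :> R[i].
  rewrite -[1]/(1 +i* 0) e2piE mulr0 oppr0 expR0 mulr1 mul1r.
  by rewrite mulr_natl cos2pi sin2pi.
have nat_case m : e2pi m%:R = 1 :> R[i].
  by rewrite -[m%:R]mul1r e2piM_natr one expr1n.
case: n => n; first exact: nat_case.
by rewrite NegzE rmorphN e2piN [X in e2pi X](_ : _ = n.+1%:R) // nat_case invr1.
Qed.

Lemma e2piDint z (n : int) : e2pi (z + n%:~R) = e2pi z.
Proof. by rewrite e2piD e2pi_int mulr1. Qed.

Lemma normc_e2pi z : normc (e2pi z) = expR (- (2 * pi * complex.Im z)).
Proof.
case: z => x y; rewrite e2piE normcM normc_real ger0_norm ?expR_ge0 //.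
by rewrite /normc cos2Dsin2 sqrtr1 mulr1.
Qed.

Lemma normc_e2pi_real x : normc (e2pi x%:C) = 1.
Proof. by rewrite normc_e2pi mulr0 oppr0 expR0. Qed.

(** The real part of e(x) is 1 - 2 sin^2 (pi x), and sin is positive on
    (0, pi). *)
Lemma e2pi_neq1 x : 0 < x < 1 -> e2pi x%:C != 1.
Proof.
move=> /andP[x0 x1]; apply/eqP => /(congr1 (@complex.Re R)).
rewrite -complexr0 e2piE mulr0 oppr0 expR0 mul1r /=.
rewrite (_ : 2 * pi * x = pi * x *+ 2); last by rewrite -mulr_natl; ring.
have p0 := pi_gt0 R.
have : 0 < sin (pi * x) by apply: sin_gt0_pi; apply/andP; split; nra.
by rewrite cos_mulr2n cos2sin2; nra.
Qed.

(** A geometric sum whose ratio e(j/N) is 1 exactly when N divides j. *)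
Lemma sum_unity_roots N (j : nat) : (0 < N)%N ->
  \sum_(a < N) e2pi (a%:R / N%:R) ^+ j = (N %| j)%:R * N%:R :> R[i].
Proof.
move=> N0; have Nn0 : N%:R != 0 :> R[i] by rewrite pnatr_eq0 -lt0n.
pose z : R[i] := e2pi ((j %% N)%:R / N%:R).
have zj (a : nat) : e2pi (a%:R / N%:R) ^+ j = z ^+ a.
  rewrite -!e2piM_natr {1}(divn_eq j N) natrD natrM.
  have -> : a%:R / N%:R * ((j %/ N)%:R * N%:R + (j %% N)%:R) =
      (j %% N)%:R / N%:R * a%:R + (a * (j %/ N))%N%:~R :> R[i].
    by rewrite -[_%:~R]/((a * (j %/ N))%N%:R) natrM; field.
  exact: e2piDint.
rewrite (eq_bigr (fun a : 'I_N => z ^+ a)) => [|a _]; last exact: zj.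
rewrite /dvdn; have [j0|j0] := eqVneq (j %% N)%N 0%N.
  rewrite mul1r (eq_bigr (fun=> 1)) ?sumr_const ?card_ord // => a _.
  by rewrite /z j0 mul0r e2pi0 expr1n.
rewrite mul0r; have z1 : z - 1 != 0.
  rewrite subr_eq0 /z -!(rmorph_nat (real_complex R)) -fmorph_div.
  have jm : (0 < j %% N)%N by rewrite lt0n.
  apply: e2pi_neq1; rewrite divr_gt0 ?ltr0n //=.
  by rewrite ltr_pdivrMr ?ltr0n // mul1r ltr_nat ltn_mod.
apply: (mulfI z1); rewrite -subrX1 mulr0 /z -e2piM_natr divfK //.
by rewrite -[_%:R]/((j %% N)%:Z%:~R) e2pi_int subrr.
Qed.

End Exponential.

Section Finite.
Variable R : realType.

(** Summing the binomial series of [(1 - x zeta) ^- K.+1] over the N-th roots of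
    unity [zeta] kills every exponent that is not a multiple of [N]. *)
Lemma has_sum_unity_roots (x : R[i]) N K : (0 < N)%N -> normc x < 1 ->
  has_sum (fun m : nat => N%:R * ('C(m * N + K, K)%:R * (x ^+ N) ^+ m))
    (\sum_(a < N) (1 - x * e2pi (a%:R / N%:R)) ^- K.+1).
Proof.
move=> N0 x1.
have zeta a : normc (e2pi (a%:R / N%:R : R[i])) = 1.
  by rewrite -!(rmorph_nat (real_complex R)) -fmorph_div normc_e2pi_real.
pose y j : R[i] := (N %| j)%:R * N%:R * ('C(j + K, K)%:R * x ^+ j).
have ys : has_sum y (\sum_(a < N) (1 - x * e2pi (a%:R / N%:R)) ^- K.+1).
  have := @has_sum_sum R nat _ (index_enum 'I_N) xpredT
    (fun a j => 'C(j + K, K)%:R * (x * e2pi (a%:R / N%:R)) ^+ j).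
  move/(_ (fun a => (1 - x * e2pi (a%:R / N%:R)) ^- K.+1)) => H.
  apply: eq_has_sum (H _) => [j|a _]; last first.
    by apply: has_sum_binomial; rewrite normcM zeta mulr1.
  rewrite /y -sum_unity_roots // mulr_suml; apply: eq_bigr => a _.
  by rewrite exprMn; ring.
pose g j := if (N %| j)%N then Some (j %/ N)%N else None.
apply: eq_has_sum (_ : has_sum (y \o (muln^~ N)) _) => [m|].
  by rewrite /= /y dvdn_mull // mul1r mulnC exprM.
apply/(has_sum_reindex (g := g)) => // [m|j|j]; rewrite /g.
- by rewrite dvdn_mull // mulnK.
- by case: ifP => //= /divnK.
- by case: ifP => // + _; rewrite /y => ->; rewrite !mul0r.
Qed.

End Finite.

(** * Lower bounds for N (1 - e((tau + n)/N)) and tau + n *)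

Section Estimates.
Variable R : realType.

(** By the mean value theorem, as the derivative cos is at least cos (pi/3) on
    the interval. *)
Lemma sin_ge_linear : exists2 c : R, 0 < c &
  forall a : R, `|a| <= pi / 3 -> c * `|a| <= `|sin a|.
Proof.
have p0 := pi_gt0 R.
exists (cos (pi / 3)); first by apply: cos_gt0_pihalf; apply/andP; split; lra.
have pos (a : R) : 0 < a -> a <= pi / 3 -> cos (pi / 3) * a <= sin a.
  move=> a0 a3.
  have sin_cont : {within `[0, a], continuous (@sin R)}%classic.
    by apply: continuous_subspaceT => x; exact: continuous_sin.
  have [x] := MVT a0 (fun x _ => is_derive_sin x) sin_cont.
  rewrite in_itv /= => /andP[x0 xa]; rewrite sin0 !subr0 => ->.
  apply: ler_wpM2r; first exact: ltW.
  by rewrite ltW // ltr_cos ?in_itv /=; [lra | apply/andP; split; lra..].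
move=> a; have [-> _|a0 a3] := eqVneq a 0; first by rewrite normr0 mulr0.
have sabs : `|sin a| = `|sin `|a| |.
  by case: (ger0P a) => // _; rewrite sinN normrN.
rewrite sabs; apply: le_trans (ler_norm _); apply: pos => //.
by rewrite normr_gt0.
Qed.

(** The bound must hold past 1/2, because the real part of (tau + n)/N ranges
    over an interval slightly longer than [-1/2, 1/2].  Halving the angle,
    sin (2 a) = 2 cos a sin a, brings it back to |a| <= pi/3. *)
Lemma sin_piM_ge_linear : exists2 c : R, 0 < c &
  forall u : R, `|u| <= 2 / 3 -> c * `|u| <= `|sin (pi * u)|.
Proof.
have p0 := pi_gt0 R; have [c c0 cP] := sin_ge_linear.
pose d : R := cos (pi / 3).
have d0 : 0 < d by apply: cos_gt0_pihalf; apply/andP; split; lra.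
exists (c * d * pi); first by rewrite !mulr_gt0.
move=> u u3; pose a := pi * u / 2.
have aabs : `|a| = pi / 2 * `|u|.
  by rewrite /a mulrAC normrM gtr0_norm //; lra.
have aE : pi * u = a *+ 2 by rewrite /a; lra.
clearbody a; have a3 : `|a| <= pi / 3 by rewrite aabs; nra.
have := cP _ a3.
have : d <= cos a.
  rewrite -cos_norm; have := normr_ge0 a; move: a3; set b := `|a| => b3 b0.
  have [->|bn] := eqVneq b (pi / 3); first by [].
  rewrite ltW // ltr_cos ?in_itv /=; [|apply/andP; split; lra..].
  by rewrite lt_neqAle bn.
rewrite aE sin_mulr2n normrMn normrM aabs => da ca.
have -> : `|cos a| = cos a by rewrite ger0_norm //; lra.
rewrite -mulr_natr; apply: (@le_trans _ _ (d * (c * (pi / 2 * `|u|)) * 2)).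
  by rewrite le_eqVlt; apply/orP; left; apply/eqP; field.
rewrite ler_pM2r //; apply: ler_pM => //; first exact: ltW.
by rewrite !mulr_ge0 ?(ltW c0) ?invr_ge0 ?(ltW p0).
Qed.

(** With w half of the argument, 1 - e(2 w) = e(w) (e(-w) - e(w)), and the
    imaginary part of the second factor is the product of sin (pi u) with
    -(exp (pi v) + exp (- pi v)), whose modulus is at least 1. *)
Lemma normc_1Be2pi_ge : exists2 c : R, 0 < c & forall u v : R,
  0 <= v -> `|u| <= 2 / 3 ->
  expR (- (pi * v)) * (c * `|u|) <= normc (1 - e2pi (u +i* v)).
Proof.
have [c c0 cP] := sin_piM_ge_linear; exists c => // u v v0 u3.
pose w : R[i] := (u / 2) +i* (v / 2).
have -> : u +i* v = w + w by apply/eqP; rewrite eq_complex /=; apply/andP; split; apply/eqP; lra.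
have w0 : e2pi w != 0.
  apply/eqP => w0; have := normc_e2pi w; rewrite w0 normc0 => /eqP.
  by rewrite lt_eqF // expR_gt0.
have -> : 1 - e2pi (w + w) = e2pi w * (e2pi (- w) - e2pi w).
  by rewrite e2piD e2piN; field.
rewrite normcM normc_e2pi /=.
have -> : 2 * pi * (v / 2) = pi * v by lra.
rewrite ler_pM2l ?expR_gt0 //; apply: le_trans (cP _ u3) _.
apply: le_trans (abs_Im_normc _).
rewrite -[- w]/((- (u / 2)) +i* (- (v / 2))) !e2piE /=.
have -> : 2 * pi * - (u / 2) = - (pi * u) by lra.
have -> : 2 * pi * (u / 2) = pi * u by lra.
have -> : 2 * pi * - (v / 2) = - (pi * v) by lra.
have -> : 2 * pi * (v / 2) = pi * v by lra.
rewrite sinN opprK cosN !mul0r !addr0 mulrN -opprD normrN -mulrDl normrM.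
rewrite ler_peMl // ger0_norm; last by rewrite addr_ge0 ?expR_ge0.
have : 1 <= expR (pi * v) by rewrite -expR0 ler_expR mulr_ge0 ?pi_ge0.
by have := expR_ge0 (- (pi * v)); lra.
Qed.


(** A quantity that dominates both a positive constant and a multiple of
    [|x + t|] dominates [1 + |t|], uniformly for bounded [x]. *)
Lemma shift_lower_bound (x X a c1 c2 t : R) : 0 < c1 -> 0 < c2 -> `|x| <= X ->
  c1 <= a -> c2 * `|x + t| <= a ->
  ((1 + X) / c1 + c2^-1)^-1 * (1 + `|t|) <= a.
Proof.
move=> c10 c20 xX c1a c2a; have X0 : 0 <= X := le_trans (normr_ge0 _) xX.
have d0 : 0 < (1 + X) / c1 + c2^-1.
  by rewrite ltr_pwDl ?divr_gt0 ?invr_ge0 ?(ltW c20) //; lra.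
rewrite ler_pdivrMl // mulrDl.
have h1 : 1 + X <= (1 + X) / c1 * a.
  by rewrite mulrAC ler_pdivlMr // ler_wpM2l //; lra.
have h2 : `|x + t| <= c2^-1 * a by rewrite ler_pdivlMl.
have h3 : `|t| <= `|x + t| + `|x|.
  by have := ler_normB (x + t) x; rewrite addrAC subrr add0r.
lra.
Qed.

Lemma normc_exprN_le (d : R) (z : R[i]) (n : int) k : 0 < d -> (2 <= k)%N ->
  d * (1 + `|n%:~R|) <= normc z ->
  normc (z ^- k) <= d ^- k * (1 + `|n%:~R|) ^- 2.
Proof.
move=> d0 k2 dz; rewrite normcV normcX; have t0 := normr_ge0 (n%:~R : R).
set t := 1 + _ in dz *; have t1 : 1 <= t by rewrite /t; lra.
have tp : 0 < t by lra.
apply: (@le_trans _ _ ((d * t) ^- k)).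
  by rewrite lef_pV2 ?posrE ?exprn_gt0 ?lerXn2r ?nnegrE ?normc_ge0 ?mulr_gt0 //;
     rewrite ?(lt_le_trans _ dz) ?mulr_gt0 // mulr_ge0 // ltW.
rewrite exprMn invfM ler_wpM2l ?invr_ge0 ?exprn_ge0 ?(ltW d0) //.
by rewrite lef_pV2 ?posrE ?exprn_gt0 // ler_weXn2l.
Qed.

Lemma normc_shift_ge (y X : R) : 0 < y -> exists2 d : R, 0 < d &
  forall (z : R[i]) (n : int), complex.Im z = y -> `|complex.Re z| <= X ->
    d * (1 + `|n%:~R|) <= normc (z + n%:~R).
Proof.
move=> y0; exists ((1 + `|X|) / y + 1^-1)^-1.
  by rewrite invr_gt0 ltr_pwDr ?invr1 ?ltr01 // divr_ge0 ?(ltW y0) ?addr_ge0.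
move=> z n zy zX; have zX' := le_trans zX (ler_norm X).
have nC : (n%:~R : R[i]) = (n%:~R : R)%:C by rewrite rmorph_int.
apply: shift_lower_bound zX' _ _ => //.
  apply: le_trans (abs_Im_normc _); rewrite nC; case: z zy {zX} => a b /= ->.
  by rewrite addr0 ler_norm.
rewrite mul1r; apply: le_trans (abs_Re_normc _); rewrite nC.
by case: z {zy zX}.
Qed.

(** The integers [j] with [|j| <= n.+1] cover a complete system of residues
    modulo [N = 2 * n.+1].  For such [j] and large [n] the real part of
    (tau + j)/N is at most 2/3 in modulus, which gives the lower bound in
    |Re tau + j|; the constant lower bound comes from 1 - |e((tau + j)/N)|. *)
Lemma normc_rescaled_ge (tau : R[i]) : 0 < complex.Im tau ->
  exists2 d : R, 0 < d & exists M0 : nat, forall (n : nat) (j : int),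
    (M0 <= n)%N -> `|j%:~R| <= n.+1%:R :> R ->
    d * (1 + `|j%:~R|) <=
      normc ((n.*2.+1).+1%:R * (1 - e2pi ((tau + j%:~R) / (n.*2.+1).+1%:R))).
Proof.
case: tau => x y /= y0; have [c c0 cP] := normc_1Be2pi_ge.
have p0 := pi_gt0 R.
pose c1 := 2 * pi * y * expR (- (2 * pi * y)).
pose c2 := expR (- (pi * y)) * c.
have c10 : 0 < c1 by rewrite !mulr_gt0 ?expR_gt0.
have c20 : 0 < c2 by rewrite mulr_gt0 ?expR_gt0.
exists ((1 + `|x|) / c1 + c2^-1)^-1.
  by rewrite invr_gt0 ltr_pwDr ?invr_gt0 // divr_ge0 ?(ltW c10) ?addr_ge0.
have [M0 M0P] : exists M0 : nat, 3 * `|x| <= M0%:R.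
  by exists (Num.bound (3 * `|x|)); apply/ltW/archi_boundP; rewrite mulr_ge0.
exists M0 => n j M0n jn; set N := n.*2.+2.
have N0 : 0 < N%:R :> R by [].
have NE : N%:R = 2 * n.+1%:R :> R by rewrite -natrM mul2n.
have N1 : 1 <= N%:R :> R by rewrite ler1n.
pose v := y / N%:R; pose u := (x + j%:~R) / N%:R.
have -> : (x +i* y + j%:~R) / N%:R = u +i* v :> R[i].
  rewrite -(rmorph_nat (real_complex R)) -(rmorph_int (real_complex R)).
  rewrite -fmorphV; apply/eqP; rewrite eq_complex /u /v /=.
  by apply/andP; split; apply/eqP; ring.
have v0 : 0 < v by rewrite divr_gt0.
have vy : v <= y by rewrite ler_pdivrMr // ler_peMr // ltW.
rewrite normcM normc_nat; apply: shift_lower_bound => //.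
  have e2n : normc (e2pi (u +i* v)) = expR (- (2 * pi * v)) by rewrite normc_e2pi.
  apply: (@le_trans _ _ (N%:R * (1 - expR (- (2 * pi * v))))); last first.
    rewrite ler_pM2l // -e2n lerBlDr.
    have := le_normcD (1 - e2pi (u +i* v)) (e2pi (u +i* v)).
    by rewrite subrK normc1.
  have : 2 * pi * v * expR (- (2 * pi * v)) <= 1 - expR (- (2 * pi * v)).
    have := expR_ge1Dx (2 * pi * v); have := expRxMexpNx_1 (2 * pi * v).
    by have := expR_gt0 (- (2 * pi * v)); nra.
  rewrite -(ler_pM2l N0); apply: le_trans.
  rewrite mulrA (_ : N%:R * (2 * pi * v) = 2 * pi * y); last first.
    by rewrite /v; field; rewrite gt_eqF.
  rewrite ler_pM2l ?mulr_gt0 // ler_expR lerN2 ler_pM2l ?mulr_gt0 //.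
have u3 : `|u| <= 2 / 3.
  rewrite normrM normfV (gtr0_norm N0) ler_pdivrMr //.
  have := ler_normD x j%:~R.
  have : M0%:R <= n.+1%:R :> R by rewrite ler_nat leqW.
  by rewrite NE; lra.
have := cP u v (ltW v0) u3.
rewrite -(ler_pM2l N0); apply: le_trans.
rewrite (_ : `|x + j%:~R| = N%:R * `|u|); last first.
  by rewrite /u normrM normfV (gtr0_norm N0); field; rewrite gt_eqF.
rewrite mulrCA ler_pM2l // mulrA ler_wpM2r // ler_wpM2r ?(ltW c0) //.
by rewrite ler_expR lerN2 ler_pM2l.
Qed.

End Estimates.

(** * The Lipschitz formula *)

Section Lipschitz.
Variable R : realType.
Implicit Types (tau w : R[i]).

(** Real and imaginary parts of 1 - e(w t) are differentiable at t = 0; the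
    limit is the derivative along the steps t = 1/N with N = 2 (n + 1). *)
Lemma tends_rescaled w :
  tends (fun n => (n.*2.+1).+1%:R * (1 - e2pi (w / (n.*2.+1).+1%:R)))
    (- (2 * pi)%:C * 'i%C * w).
Proof.
case: w => x y.
pose f1 (t : R) : R := expR (- (2 * pi * y) * t) * cos (2 * pi * x * t).
pose f2 (t : R) : R := expR (- (2 * pi * y) * t) * sin (2 * pi * x * t).
have lin a : is_derive (0 : R) 1 (fun t : R => a * t) a.
  by apply: is_derive_eq; rewrite /GRing.scale /= mulr1.
have dexp a : is_derive (0 : R) 1 (fun t : R => expR (a * t)) a.
  have := @is_derive1_comp R expR (fun t => a * t) 0 _ _ (is_derive_expR _) (lin a).
  by rewrite mulr0 expR0 mul1r.
have dcos a : is_derive (0 : R) 1 (fun t : R => cos (a * t)) 0.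
  have := @is_derive1_comp R cos (fun t => a * t) 0 _ _ (is_derive_cos _) (lin a).
  by rewrite mulr0 sin0 oppr0 mul0r.
have dsin a : is_derive (0 : R) 1 (fun t : R => sin (a * t)) a.
  have := @is_derive1_comp R sin (fun t => a * t) 0 _ _ (is_derive_sin _) (lin a).
  by rewrite mulr0 cos0 mul1r.
have d1 : is_derive (0 : R) 1 f1 (- (2 * pi * y)).
  have := is_deriveM (dexp (- (2 * pi * y))) (dcos (2 * pi * x)).
  by rewrite !mulr0 expR0 cos0 scaler0 add0r scale1r.
have d2 : is_derive (0 : R) 1 f2 (2 * pi * x).
  have := is_deriveM (dexp (- (2 * pi * y))) (dsin (2 * pi * x)).
  by rewrite !mulr0 expR0 sin0 scale0r addr0 scale1r.
have := tendsD (tendsM (tends_cst (-1)) (tends_diffquot d1))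
  (tendsM (tends_cst (- 'i%C)) (tends_diffquot d2)).
have -> : -1 * (- (2 * pi * y))%:C + - 'i%C * (2 * pi * x)%:C
    = - (2 * pi)%:C * 'i%C * (x +i* y) :> R[i].
  by apply/eqP; rewrite eq_complex /=; apply/andP; split; apply/eqP; ring.
move/(@tends_comp _ _ _ (fun n => n.*2.+1)) => H.
apply: (tends_near_eq (N0 := 0%N)) (H _) => [n _|n]; last by rewrite -addnn leqW ?leq_addr.
rewrite /=; set N := n.*2.+2.
have -> : (x +i* y) / N%:R = (x / N%:R) +i* (y / N%:R) :> R[i].
  rewrite -(rmorph_nat (real_complex R)) -fmorphV.
  by apply/eqP; rewrite eq_complex /=; apply/andP; split; apply/eqP; ring.
rewrite e2piE /f1 /f2 !mulr0 expR0 cos0 sin0 mulr0 !mulrA !mulNr.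
rewrite -(rmorph_nat (real_complex R)).
by apply/eqP; rewrite eq_complex /=; apply/andP; split; apply/eqP; ring.
Qed.

(** After multiplication by [K!] both sides are products of [K] factors, and
    m N + j <= (m + j) N. *)
Lemma leq_bin_rescale m N K : (0 < N)%N ->
  ('C(m * N + K, K) <= 'C(m + K, K) * N ^ K)%N.
Proof.
move=> N0; rewrite -(leq_pmul2r (fact_gt0 K)) mulnAC !bin_ffact !ffact_prod.
rewrite -[X in (_ ^ X)%N]card_ord -prod_nat_const -big_split /=.
by apply: leq_prod => i _; have := ltn_ord i; nia.
Qed.

Lemma lipschitz_formula tau K : 0 < complex.Im tau -> (0 < K)%N ->
  exists L, has_sum (fun n : int => (tau + n%:~R) ^- K.+1) L /\
    has_sum (fun m : nat => (- (2 * pi)%:C * 'i%C) ^+ K.+1 * m%:R ^+ K / K`!%:R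
                            * e2pi tau ^+ m) L.
Proof.
move=> tau0 K0; pose N n := n.*2.+2.
have p0 := pi_gt0 R.
pose F n (j : int) : R[i] :=
  ((N n)%:R * (1 - e2pi ((tau + j%:~R) / (N n)%:R))) ^- K.+1.
pose X n (j : int) : R[i] := if (- n.+1%:Z <= j < n.+1%:Z) then F n j else 0.
pose S n : R[i] := \sum_(a < N n) F n (a%:Z - n.+1%:Z).
pose Y n m : R[i] := (N n)%:R ^- K.+1 *
  ((N n)%:R * ('C(m * N n + K, K)%:R * e2pi tau ^+ m)).
have q1 : normc (e2pi tau) < 1.
  by rewrite normc_e2pi expR_lt1 oppr_lt0 !mulr_gt0.
(* [S n] sums over all residues modulo [N n], shifted so as to be centred at 0. *)
have XS n : has_sum (X n) (S n).
  pose f (a : 'I_(N n)) : int := a%:Z - n.+1%:Z.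
  pose g (j : int) : option 'I_(N n) :=
    if (- n.+1%:Z <= j < n.+1%:Z) then insub (absz (j + n.+1%:Z)) else None.
  have inf a : - n.+1%:Z <= f a < n.+1%:Z.
    by have := ltn_ord a; rewrite /f /N; lia.
  apply/(has_sum_reindex (f := f) (g := g)).
  - move=> a; rewrite /g inf /f subrK absz_nat; exact: valK.
  - move=> j; rewrite /g; case: ifP => // jn; case: insubP => //= a _ aj.
    rewrite /f aj; lia.
  - move=> j; rewrite /g /X; case: ifP => // jn.
    by rewrite insubT //; rewrite /N; lia.
  - apply: eq_has_sum (has_sum_fin _) => a; by rewrite /= /X inf.
have NC n : (N n)%:R != 0 :> R[i] by rewrite pnatr_eq0.
(* The same finite sum, by the roots of unity identity with x = e((tau - n - 1)/N):
   the integral shift disappears in x^N = e(tau). *)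
have YS n : has_sum (Y n) (S n).
  pose x : R[i] := e2pi ((tau - n.+1%:R) / (N n)%:R).
  have xN : x ^+ N n = e2pi tau.
    rewrite -e2piM_natr divfK // -[in RHS](e2piDint tau (- n.+1%:Z)).
    by rewrite rmorphN.
  have x1 : normc x < 1.
    rewrite ltNge; apply: contraL q1 => x1.
    by rewrite -xN normcX -leNgt exprn_ege1.
  have := has_sumZ ((N n)%:R ^- K.+1) (has_sum_unity_roots K (isT : 0 < N n)%N x1).
  rewrite mulr_sumr xN => H; rewrite /S.
  rewrite (eq_bigr (fun a : 'I_(N n) => (N n)%:R ^- K.+1 *
    (1 - x * e2pi (a%:R / (N n)%:R)) ^- K.+1)); first exact: H.
  move=> a _; rewrite /F -invfM -exprMn /x -e2piD -mulrDl.
  by rewrite rmorphB addrA [in RHS]addrAC.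
have [d d0 [M0 dP]] := normc_rescaled_ge tau0.
have c0 : - (2 * pi)%:C * 'i%C != 0 :> R[i].
  apply: mulf_neq0; last by rewrite eq_complex /= oner_eq0 andbF.
  by rewrite oppr_eq0 fmorph_eq0 mulf_neq0 ?pnatr_eq0 ?gt_eqF.
have tauj (j : int) : tau + j%:~R != 0.
  apply: contraTneq tau0 => /(congr1 (@complex.Im R)).
  rewrite -(rmorph_int (real_complex R)) raddfD /= addr0 => ->.
  by rewrite ltxx.
have [s [Xs Ss]] : exists s, has_sum
    (fun j : int => (- (2 * pi)%:C * 'i%C * (tau + j%:~R)) ^- K.+1) s /\ tends S s.
  apply: (tends_has_sum (b := fun j => d ^- K.+1 * (1 + `|j%:~R|) ^- 2)
    (N0 := M0) XS).
  - move=> j; apply: (@tends_near_eq _ (F^~ j) _ _ (absz j)).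
      by move=> n jn; rewrite /X ifT //; lia.
    apply: tendsV; first by rewrite expf_neq0 // mulf_neq0.
    exact: tendsX (tends_rescaled _).
  - move=> n j Mn; rewrite /X; case: ifP => [jn|_].
      apply: normc_exprN_le => //; apply: dP => //.
      by rewrite -intr_norm -[n.+1%:R]/(n.+1%:~R) ler_int; lia.
    by rewrite normc0 mulr_ge0 // invr_ge0 exprn_ge0 ?addr_ge0 // ltW.
  - apply: sums_leZ (@sums_le_int R); by rewrite invr_ge0 exprn_ge0 // ltW.
have [s' [Ys' Ss']] : exists s, has_sum
    (fun m : nat => m%:R ^+ K / K`!%:R * e2pi tau ^+ m) s /\ tends S s.
  apply: (tends_has_sum (b := fun m => 'C(m + K, K)%:R * normc (e2pi tau) ^+ m)
    (N0 := 0%N) YS).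
  - move=> m.
    have -> : m%:R ^+ K / K`!%:R * e2pi tau ^+ m =
        K`!%:R^-1 * e2pi tau ^+ m * \prod_(i < K) (m%:R + (K - i)%:R * 0) :> R[i].
      rewrite (eq_bigr (fun=> m%:R)) => [|i _]; last by rewrite mulr0 addr0.
      by rewrite prodr_const card_ord; ring.
    have Ninv : tends (fun n => ((N n)%:R : R[i])^-1) 0.
      apply: (@tends_comp _ _ _ (fun n => n.*2.+1) _ (@tends_inv_nat R)) => n.
      by rewrite -addnn leqW ?leq_addr.
    have := tendsM (tends_cst (K`!%:R^-1 * e2pi tau ^+ m))
      (@tends_prod R 'I_K (index_enum 'I_K) (fun i n => m%:R + (K - i)%:R * (N n)%:R^-1)
        (fun i => m%:R + (K - i)%:R * 0)
        (fun i => tendsD (tends_cst _) (tendsM (tends_cst _) Ninv))).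
    apply: (tends_near_eq (N0 := 0%N)) => n _; rewrite /Y.
    have -> : 'C(m * N n + K, K)%:R =
       (N n)%:R ^+ K * \prod_(i < K) (m%:R + (K - i)%:R / (N n)%:R) / K`!%:R :> R[i].
      rewrite -[X in _ ^+ X]card_ord -prodr_const -big_split /=.
      apply: (canRL (mulfK _)); first by rewrite pnatr_eq0 -lt0n fact_gt0.
      rewrite -natrM bin_ffact ffact_prod natr_prod; apply: eq_bigr => i _.
      by rewrite -addnBA 1?ltnW // natrD natrM; field; exact: NC.
    rewrite exprS invfM; field.
    by rewrite expf_neq0 ?NC // pnatr_eq0 -lt0n fact_gt0.
  - move=> n m _; rewrite /Y /=; move: (e2pi tau) => q.
    rewrite !normcM normcV !normcX !normc_nat.
    have N0 : 0 < (N n)%:R :> R by [].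
    rewrite [leLHS](_ : _ = 'C(m * N n + K, K)%:R / (N n)%:R ^+ K *
      normc q ^+ m); last first.
      by rewrite exprS; field; rewrite ?expf_neq0 gt_eqF.
    rewrite ler_wpM2r ?exprn_ge0 ?normc_ge0 //.
    rewrite ler_pdivrMr ?exprn_gt0 // -natrX -natrM ler_nat.
    exact: leq_bin_rescale.
  - by apply: sums_le_binomial; rewrite normc_ge0.
have ss' := tends_unique Ss Ss'; rewrite -{s' Ss'}ss' in Ys'.
move: (- (2 * pi)%:C * 'i%C) c0 Xs => c c0 Xs.
exists (c ^+ K.+1 * s); split.
  apply: eq_has_sum (has_sumZ _ Xs) => j.
  by rewrite exprMn invfM mulrA mulfV ?mul1r // expf_neq0.
by apply: eq_has_sum (has_sumZ _ Ys') => m; rewrite !mulrA.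
Qed.

End Lipschitz.

(** * Symmetries of the twisted weights *)

Section Weights.
Variable R : realType.
Implicit Types (h : R[i] -> R[i]) (l : nat) (i c d n : int).

(** The translation by [n] is an element of Gamma0(l). *)
Lemma cusp_form_translate w l h n (z : R[i]) : cusp_form w l h ->
  0 < complex.Im z -> h (z + n%:~R) = h z.
Proof.
move=> hh z0; pose g : 'M[int]_2 :=
  \matrix_(a, b) (if a == b then 1 else if a == 0 then n else 0).
have gG : Gamma0 l g.
  split; last by rewrite mxE /= dvdz0.
  have gT : is_trig_mx g^T.
    apply/is_trig_mxP => a b ab; rewrite !mxE.
    by move: a b ab => [[|[|a]] ?] [[|[|b]] ?].
  by rewrite /SL2Z -det_tr det_trig // !big_ord_recl big_ord0 !mxE.
have := cusp_form_mod hh gG z0; rewrite /slash /moebius /autfactor !mxE /=.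
by rewrite mul0r add0r mul1r expr1n invr1 mul1r mulr1.
Qed.

Lemma eichler_translate w l h (x : R) n : cusp_form w l h ->
  eichler h (x + n%:~R)%:C = eichler h x%:C.
Proof.
move=> hh; rewrite /eichler; congr (_ * _); rewrite /integralC /=.
have hE : {in `]0, +oo[%classic, (fun t => h ((x + n%:~R) +i* t)) =1
    fun t => h (x +i* t)}.
  move=> t; rewrite inE /= in_itv /= andbT => t0.
  rewrite -(@cusp_form_translate w l h n (x +i* t) hh) //; congr h.
  by rewrite -(rmorph_int (real_complex R)); apply/eqP; rewrite eq_complex /= addr0 !eqxx.
by congr (_ +i* _); apply: eq_Rintegral => t /hE /= ->.
Qed.

Lemma eichler_cusp_periodic w l h c d n : cusp_form w l h ->
  eichler_cusp h c (d + n * c) = eichler_cusp h c d.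
Proof.
move=> hh; rewrite /eichler_cusp; case: eqP => // /eqP c0.
rewrite rmorphD rmorphM /= mulrDl mulfK ?intr_eq0 //.
rewrite opprD -[- n%:~R]rmorphN.
exact: (eichler_translate _ _ hh).
Qed.

Lemma eichler_cuspN h c d : eichler_cusp h (- c) (- d) = eichler_cusp h c d.
Proof.
by rewrite /eichler_cusp oppr_eq0 !rmorphN invrN mulrNN.
Qed.

Lemma twist_periodic l i d n : (0 < l)%N -> @twist R l i (d + n * l%:Z) = @twist R l i d.
Proof.
move=> l0; rewrite /twist mulrDl rmorphD mulrDl -[X in _ = e2pi X]addr0 /=.
rewrite [in RHS]addr0 -[RHS](@e2piDint R _ (n * i)); congr (e2pi (_ + _)).
have l0' : l%:R != 0 :> R[i] by rewrite pnatr_eq0 -lt0n.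
by rewrite !rmorphM /= -[l%:~R]/(l%:R); field.
Qed.

Lemma twistNN l i d : @twist R l (- i) (- d) = @twist R l i d.
Proof. by rewrite /twist mulrNN. Qed.

Lemma normc_twist l i d : normc (@twist R l i d) = 1.
Proof.
rewrite /twist -(rmorph_int (real_complex R)) -(rmorph_nat (real_complex R)).
by rewrite -fmorph_div normc_e2pi_real.
Qed.

Lemma coprimez_periodic d n (l : int) : coprimez (d + n * l) l = coprimez d l.
Proof. by rewrite /coprimez gcdzC addrC gcdzMDl gcdzC. Qed.

End Weights.

(** * Rows of the lattice sum *)

Section Rows.
Variable R : realType.
Implicit Types (tau : R[i]).

(** Division with remainder by [c], as a bijection between the integers and
    ['I_c * int]. *)
Section Residues.
Variable c : nat.
Hypothesis c0 : (0 < c)%N.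

Definition of_residue (p : 'I_c * int) : int := p.1%:Z + p.2 * c%:Z.

Let residue_proof d : (absz (d %% c%:Z)%Z < c)%N.
Proof.
have := ltz_pmod d (c0 : 0 < c%:Z); have := modz_ge0 d (_ : c%:Z != 0).
lia.
Qed.

Definition to_residue (d : int) : 'I_c * int :=
  (Ordinal (residue_proof d), (d %/ c%:Z)%Z).

Lemma of_residueK : cancel of_residue to_residue.
Proof.
move=> [a n]; rewrite /to_residue /of_residue /=; have ac := ltn_ord a.
have cz : c%:Z != 0 by lia.
congr (_, _); last by rewrite addrC divzMDl // divz_small ?addr0 //; lia.
by apply: val_inj => /=; rewrite addrC modzMDl modz_small //; lia.
Qed.

Lemma to_residueK : cancel to_residue of_residue.
Proof.
move=> d; rewrite /to_residue /of_residue /=.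
rewrite {3}(divz_eq d c%:Z) addrC; congr (_ + _).
by rewrite gez0_abs // modz_ge0 //; lia.
Qed.

Lemma lattice_residue tau (p : 'I_c * int) :
  c%:R * tau + (of_residue p)%:~R
    = c%:R * (tau + p.1%:R / c%:R + p.2%:~R) :> R[i].
Proof.
have cC : c%:R != 0 :> R[i] by rewrite pnatr_eq0 -lt0n.
rewrite /of_residue rmorphD rmorphM /= -[c%:~R]/(c%:R) -[p.1%:~R]/(p.1%:R).
by field.
Qed.

(** Each residue class d0 modulo c contributes
    c^-k v(d0) sum_n (tau + d0/c + n)^-k; the Lipschitz formula at tau + d0/c
    turns it into a power series in e(tau) with the extra factors e(m d0/c). *)
Lemma lattice_row_expansion tau K (v : int -> R[i]) : 0 < complex.Im tau -> (0 < K)%N ->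
  (forall d n, v (d + n * c%:Z) = v d) ->
  exists y, has_sum (fun d : int => (c%:R * tau + d%:~R) ^- K.+1 * v d) y /\
   has_sum (fun m : nat => (- (2 * pi)%:C * 'i%C) ^+ K.+1 * m%:R ^+ K / K`!%:R
        * e2pi tau ^+ m
        * \sum_(d < c) c%:R ^- K.+1 * v d%:Z * e2pi (m%:R * (d%:R / c%:R))) y.
Proof.
move=> tau0 K0 vper.
have tau_a (a : 'I_c) : 0 < complex.Im (tau + a%:R / c%:R).
  rewrite -!(rmorph_nat (real_complex R)) -fmorph_div; case: tau tau0 => x y /=.
  by rewrite addr0.
have [L LP] : exists L : 'I_c -> R[i], forall a : 'I_c,
    has_sum (fun n : int => (tau + a%:R / c%:R + n%:~R) ^- K.+1) (L a) /\
    has_sum (fun m : nat => (- (2 * pi)%:C * 'i%C) ^+ K.+1 * m%:R ^+ K / K`!%:R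
                            * e2pi (tau + a%:R / c%:R) ^+ m) (L a).
  exists (fun a => sval (cid (lipschitz_formula (tau_a a) K0))) => a.
  by case: cid.
exists (\sum_(a : 'I_c) c%:R ^- K.+1 * v a%:Z * L a); split.
  apply/(has_sum_bij _ _ of_residueK to_residueK).
  apply: has_sum_finprod => a.
  apply: eq_has_sum (has_sumZ (c%:R ^- K.+1 * v a%:Z) (LP a).1) => n /=.
  rewrite lattice_residue /= {1}/of_residue vper exprMn invfM; ring.
have := @has_sum_sum R _ _ (index_enum 'I_c) xpredT _ _
  (fun a _ => has_sumZ (c%:R ^- K.+1 * v a%:Z) (LP a).2).
apply: eq_has_sum => m; rewrite mulr_sumr; apply: eq_bigr => a _.
rewrite e2piD [(e2pi tau * _) ^+ m]exprMn [m%:R * (_ / _)]mulrC e2piM_natr; ring.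
Qed.

(** There are c residue classes, and each contributes at most
    c^-k d^-k sum_n (1 + |n|)^-2: the row is O(c^(1-k)). *)
Lemma sums_le_row tau k (d : R) : 0 < d -> (2 <= k)%N ->
  (forall (a : 'I_c) (n : int),
     d * (1 + `|n%:~R|) <= normc (tau + a%:R / c%:R + n%:~R)) ->
  sums_le (fun j : int => normc ((c%:R * tau + j%:~R) ^- k))
    (c%:R * (c%:R ^- k * (d ^- k * 4))).
Proof.
move=> d0 k2 dP.
pose b (p : 'I_c * int) : R := normc ((c%:R * tau + (of_residue p)%:~R) ^- k).
have bM : sums_le b (c%:R * (c%:R ^- k * (d ^- k * 4))).
  apply: (@sums_le_prod _ _ _ _ (fun=> c%:R ^- k * (d ^- k * 4))).
  - by move=> p; exact: normc_ge0.
  - move=> a; apply: sums_le_le (_ : sums_le (fun n : int => c%:R ^- k *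
        (d ^- k * (1 + `|n%:~R|) ^- 2)) _) => [n|].
      rewrite /b lattice_residue exprMn invfM normcM normcV normcX normc_nat.
      rewrite ler_wpM2l ?invr_ge0 ?exprn_ge0 //.
      exact: normc_exprN_le.
    apply: sums_leZ; first by rewrite invr_ge0 exprn_ge0.
    apply: sums_leZ (@sums_le_int R).
    by rewrite invr_ge0 exprn_ge0 // ltW.
  - rewrite (_ : c%:R * _ = \sum_(a : 'I_c) c%:R ^- k * (d ^- k * 4)); last first.
      by rewrite sumr_const card_ord mulr_natl.
    apply: sums_le_fin => _.
    by rewrite !mulr_ge0 // invr_ge0 exprn_ge0 // ltW.
have := sums_le_inj (can_inj to_residueK) (fun p => normc_ge0 _) bM.
by apply: sums_le_le => j; rewrite /b /= to_residueK.
Qed.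

End Residues.

End Rows.

Section Lattice.
Variable R : realType.

(** Since k >= 3 the row bound O(|c|^(1-k)) is dominated by (1 + |c|)^-2.  The
    rows c and -c are exchanged by d -> -d, and the row c = 0 is the series of
    |d|^-k, where |d| >= (1 + |d|)/2. *)
Lemma lattice_summable (tau : R[i]) k : 0 < complex.Im tau -> (3 <= k)%N ->
  exists M, sums_le (fun p : int * int => if p == (0, 0) then 0 else
    normc ((p.1%:~R * tau + p.2%:~R) ^- k)) M.
Proof.
move=> tau0 k3; have k2 : (2 <= k)%N := ltnW k3.
have [d d0 dP] := normc_shift_ge (`|complex.Re tau| + 1) tau0.
pose B := 2^-1 ^- k * 4 + 4 * (d ^- k * 4).
have dk0 : 0 < d ^- k by rewrite invr_gt0 exprn_gt0.
have row n : sums_le (fun j : int => normc ((n.+1%:R * tau + j%:~R) ^- k))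
    (B * (1 + n.+1%:R) ^- 2).
  have c0 : 0 < n.+1%:R :> R by [].
  have c1 : 1 <= n.+1%:R :> R by rewrite ler1n.
  apply: sums_le_trans (sums_le_row (ltn0Sn n) d0 k2 _) _ => [a m|].
    have aR : a%:R / n.+1%:R = (a%:R / n.+1%:R : R)%:C.
      by rewrite fmorph_div !rmorph_nat.
    apply: dP; rewrite aR raddfD /= ?addr0 //.
    apply: le_trans (ler_normD _ _) _; rewrite lerD2l ger0_norm ?divr_ge0 //.
    by rewrite ler_pdivrMr // mul1r ler_nat ltnW.
  set c : R := n.+1%:R in c0 c1 *.
  apply: (@le_trans _ _ (4 * (d ^- k * 4) * (1 + c) ^- 2)); last first.
    by rewrite ler_wpM2r ?invr_ge0 ?exprn_ge0 ?addr_ge0 // lerDr mulr_ge0 //.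
  rewrite mulrA [leRHS]mulrAC ler_wpM2r ?mulr_ge0 ?(ltW dk0) //.
  apply: (@le_trans _ _ (c ^- 2)).
    rewrite -(subnKC k3) addSn exprS invfM mulVKf ?gt_eqF //.
    rewrite lef_pV2 ?posrE ?exprn_gt0 // exprD ler_peMr ?exprn_ge0 ?(ltW c0) //.
    exact: exprn_ege1.
  rewrite ler_pdivlMr ?exprn_gt0 ?addr_gt0 // mulrC ler_pdivrMr ?exprn_gt0 //.
  by nra.
exists (B * 4); have B0 : 0 <= B.
  by rewrite addr_ge0 // !mulr_ge0 ?(ltW dk0) // invr_ge0 exprn_ge0.
apply: (sums_le_prod _ _ (sums_leZ B0 (@sums_le_int R))) => [p|c].
  by case: ifP => // _; exact: normc_ge0.
case: c => [[|n]|n] /=.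
- apply: sums_le_trans (_ : sums_le _ (2^-1 ^- k * 4)) _; last first.
    by rewrite normr0 addr0 expr1n invr1 mulr1 lerDl !mulr_ge0 // ltW.
  apply: sums_le_le (sums_leZ _ (@sums_le_int R)) => [j|]; last first.
    by rewrite invr_ge0 exprn_ge0.
  case: eqP => [_|/eqP j0].
    by rewrite mulr_ge0 // invr_ge0 exprn_ge0 // addr_ge0.
  apply: normc_exprN_le => //; rewrite mul0r add0r normc_int.
  have : 1 <= `|j%:~R| :> R.
    by rewrite -intr_norm -[1]/(1%:~R) ler_int -gtz0_ge1 normr_gt0.
  by lra.
- by rewrite ger0_norm //; apply: sums_le_le (row n) => j.
- rewrite NegzE rmorphN normrN ger0_norm //.
  have := sums_le_inj (@oppr_inj int) (fun j => normc_ge0 _) (row n).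
  apply: sums_le_le => j /=.
  rewrite !normcV !normcX -[in leRHS]normcN rmorphN opprB addrC mulNr.
  by rewrite lexx.
Qed.

End Lattice.

(** * Pairing the rows c and -c *)

Section Pairing.
Variable R : realType.
Implicit Types (h : R[i] -> R[i]) (l k m : nat) (i c d n : int) (tau : R[i]).

(** The weight of (c tau + d)^-k once the terms of (c, d) and (-c, -d) have been
    added. *)
Definition pair_weight l k i h c d : R[i] :=
  if coprimez d l%:Z then
    (@twist R l (- i) d + (-1) ^+ k * @twist R l i d)
    * e2pi (complex.Re (eichler_cusp h c d))%:C
  else 0.

Lemma pair_weight_periodic w l k i h c d n : (0 < l)%N -> cusp_form w l h ->
  (l%:Z %| c)%Z -> pair_weight l k i h c (d + n * c) = pair_weight l k i h c d.
Proof.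
move=> l0 hh /dvdzP[q cq]; rewrite /pair_weight (eichler_cusp_periodic _ _ _ hh).
by rewrite cq mulrA coprimez_periodic !twist_periodic.
Qed.

Lemma normc_pair_weight_le l k i h c d : normc (pair_weight l k i h c d) <= 2.
Proof.
rewrite /pair_weight; case: ifP => _; last by rewrite normc0.
rewrite normcM normc_e2pi_real mulr1; apply: le_trans (le_normcD _ _) _.
rewrite [normc (_ ^+ k * _)]normcM normcX normcN normc1 expr1n !normc_twist; lra.
Qed.

Lemma eis_term_pair l k i h tau c d : c != 0 ->
  eis_term l k i h tau (c, d) + eis_term l k i h tau (- c, - d) =
  if (l%:Z %| c)%Z then (c%:~R * tau + d%:~R) ^- k * pair_weight l k i h c d
  else 0.
Proof.
move=> c0; rewrite /eis_term /extend0 /= !xpair_eqE oppr_eq0 (negbTE c0) /=.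
have -> : (l%:Z %| - c)%Z = (l%:Z %| c)%Z by rewrite !dvdzE abszN.
rewrite eichler_cuspN /pair_weight /coprimez gcdNz.
case: ifP => [/andP[-> /andP[-> _]]|]; last first.
  by case: (_ %| _)%Z; case: (gcdz d l == 1) => //= _; rewrite ?mulr0 addr0.
have -> : (- c)%:~R * tau + (- d)%:~R = -1 * (c%:~R * tau + d%:~R) :> R[i].
  by rewrite !rmorphN; ring.
rewrite twistNN; move: (c%:~R * tau + d%:~R) => z.
rewrite [(-1 * z) ^+ k]exprMn invfM.
have -> : ((-1) ^+ k)^-1 = (-1) ^+ k :> R[i] by rewrite -exprVn invrN1.
ring.
Qed.

Lemma Rm_termE l k i h m (c : nat) : (0 < c)%N ->
  Rm_term l k i h m c = if (l%:Z %| c%:Z)%Z then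
    \sum_(d < c) c%:R ^- k * pair_weight l k i h c%:Z d%:Z
      * e2pi (m%:R * (d%:R / c%:R)) else 0.
Proof.
move=> c0; rewrite /Rm_term /extend0 c0 dvdzE /=; case: ifP => // _.
rewrite big_mkcond; apply: eq_bigr => d _; rewrite /pair_weight coprimezE /=.
by case: ifP => _; [rewrite e2piD; ring | rewrite mulr0 mul0r].
Qed.

(** A sum of c terms of modulus at most 2 c^-k. *)
Lemma normc_Rm_term_le l k i h m (n : nat) : (3 <= k)%N ->
  normc (Rm_term l k i h m n.+1) <= 2 * n.+1%:R ^- 2.
Proof.
move=> k3; rewrite Rm_termE //; have c0 : 0 < n.+1%:R :> R by [].
have c1 : 1 <= n.+1%:R :> R by rewrite ler1n.
case: ifP => _; last by rewrite normc0 mulr_ge0 // invr_ge0 exprn_ge0.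
apply: le_trans (normc_sum _ _ _) _.
apply: (@le_trans _ _ (\sum_(d < n.+1) n.+1%:R ^- k * 2)).
  apply: ler_sum => d _.
  have -> : m%:R * (d%:R / n.+1%:R) = (m%:R * (d%:R / n.+1%:R) : R)%:C.
    by rewrite rmorphM fmorph_div !rmorph_nat.
  rewrite normcM normcM normcV normcX normc_nat.
  rewrite normc_e2pi_real mulr1 ler_wpM2l ?invr_ge0 ?exprn_ge0 //.
  exact: normc_pair_weight_le.
rewrite sumr_const card_ord -[leLHS]mulr_natl mulrA mulrC ler_pM2l //.
rewrite -(subnKC k3) addSn exprS invfM mulVKf ?gt_eqF //.
rewrite lef_pV2 ?posrE ?exprn_gt0 // exprD ler_peMr ?exprn_ge0 //.
exact: exprn_ege1.
Qed.

End Pairing.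

Theorem corollary2p8 (R : realType) (l : nat) (h : R[i] -> R[i]) (i : int)
    (k : nat) (tau : R[i]) (hl : (1 <= l)%N) (hh : cusp_form 2 l h)
    (hk : (3 <= k)%N) (htau : 0 < complex.Im tau) :
  [/\ usummable (eis_term l k i h tau),
      usummable (@R0_term R l k i),
      forall m : nat, (0 < m)%N -> usummable (Rm_term l k i h m),
      usummable (qexp_term l k i h tau)
    & twisted_eisenstein l k i h tau
      = R0 R l k i + usum (qexp_term l k i h tau)].
Proof.
pose x := eis_term l k i h tau.
have x_le p : normc (x p) <= if p == (0, 0) then 0 else
    normc ((p.1%:~R * tau + p.2%:~R) ^- k).
  rewrite /x /eis_term /extend0; case: eqP => [_|_].
    by rewrite !andbF normc0.
  case: ifP => _; last by rewrite normc0 normc_ge0.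
  by rewrite normcM normcM normc_twist normc_e2pi_real !mulr1.
have [M xM] := lattice_summable htau hk.
have {x_le} xM := sums_le_le x_le xM.
have [E xE] := abs_has_sum xM.
have row c : exists s, has_sum (fun d => x (c, d)) s.
  apply: (@abs_has_sum _ _ _ M).
  have pairI : injective (pair c : int -> int * int) by move=> d d' [].
  exact: (sums_le_inj pairI (fun p => normc_ge0 _) xM).
have [y yP] : exists y : int -> R[i], forall c, has_sum (fun d => x (c, d)) (y c).
  by exists (fun c => sval (cid (row c))) => c; case: cid.
have yE : has_sum y E := has_sum_fubini xE yP.
have R0y : has_sum (@R0_term R l k i) (y 0).
  apply: eq_has_sum (yP 0) => d; rewrite /x /eis_term /R0_term /extend0 /=.
  rewrite dvdz0 xpair_eqE eqxx /=; case: ifP => // _.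
  by rewrite mul0r add0r /eichler_cusp /= e2pi0 mulr1.
have zE : has_sum (fun n : nat => y n.+1%:Z + y (- n.+1%:Z)) (E - y 0).
  exact: has_sum_int_pairs.
have K0 : (0 < k.-1)%N by lia.
pose A m : R[i] := (- (2 * pi)%:C * 'i%C) ^+ k * m%:R ^+ k.-1 / (k.-1)`!%:R
  * e2pi tau ^+ m.
(* The double family of the q-expansion.  [A 0] vanishes because k > 1, so the
   exponent m = 0 may be kept. *)
pose X (p : nat * nat) : R[i] := A p.1 * Rm_term l k i h p.1 p.2.+1.
have Rm_sum m : exists s, has_sum (fun n => Rm_term l k i h m n.+1) s.
  apply: (@abs_has_sum _ _ _ (2 * 2)).
  apply: sums_le_le (@sums_leZ R nat _ 2 2 _ (@sums_le_inv_sqr R)) => // n.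
  exact: (normc_Rm_term_le _ _ _ _ _ hk).
have Rm_has m : has_sum (Rm_term l k i h m) (usum (Rm_term l k i h m)).
  have [s sP] := Rm_sum m; suff : has_sum (Rm_term l k i h m) s.
    by move=> ms; rewrite (has_sum_usum ms).
  by apply/has_sum_succ.
have kE : k = k.-1.+1 by lia.
have row_z n : has_sum (fun m => X (m, n)) (y n.+1%:Z + y (- n.+1%:Z)).
  have yN : has_sum (fun d => x (- n.+1%:Z, - d)) (y (- n.+1%:Z)).
    exact/(has_sum_bij (fun d => x (- n.+1%:Z, d)) _ (@opprK int) (@opprK int)).
  have := has_sumD (yP n.+1%:Z) yN => yy.
  have := eq_has_sum (fun d => @eis_term_pair R l k i h tau n.+1%:Z d isT) yy.
  have XE m : X (m, n) = A m * Rm_term l k i h m n.+1 by [].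
  case ln: (l%:Z %| n.+1%:Z)%Z => pairs; last first.
    rewrite -(has_sum_unique (@has_sum0 R int) pairs).
    apply: eq_has_sum (@has_sum0 R nat) => m.
    by rewrite XE Rm_termE // ln mulr0.
  have [Y [YP]] := @lattice_row_expansion R n.+1 isT tau k.-1
    (pair_weight l k i h n.+1%:Z) htau K0
    (fun d j => pair_weight_periodic k i d j hl hh ln).
  rewrite -kE in YP *; rewrite (has_sum_unique pairs YP).
  by apply: eq_has_sum => m; rewrite XE Rm_termE // ln.
have [T XT] : exists T, has_sum X T.
  have q1 : 0 <= normc (e2pi tau) < 1.
    by rewrite normc_ge0 normc_e2pi expR_lt1 oppr_lt0 !mulr_gt0 ?pi_gt0.
  pose a := normc (- (2 * pi)%:C * 'i%C : R[i]) ^+ k.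
  have a0 : 0 <= a by rewrite exprn_ge0 ?normc_ge0.
  have A_le m : normc (A m) * 4 <=
      4 * a * ('C(m + k.-1, k.-1)%:R * normc (e2pi tau) ^+ m).
    rewrite /A; move: (e2pi tau) => q.
    move: a0; rewrite /a; move: (- (2 * pi)%:C * 'i%C) => b a0.
    rewrite !normcM normcV !normcX !normc_nat.
    have mK : m%:R ^+ k.-1 / (k.-1)`!%:R <= 'C(m + k.-1, k.-1)%:R :> R.
      rewrite ler_pdivrMr ?ltr0n ?fact_gt0 // -natrX -natrM ler_nat.
      rewrite bin_ffact ffact_prod -[X in (_ ^ X)%N]card_ord -prod_nat_const.
      by apply: leq_prod => j _; have := ltn_ord j; lia.
    rewrite -[leRHS]mulrA [leLHS]mulrC ler_wpM2l //.
    rewrite -!mulrA ler_wpM2l // mulrA.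
    by rewrite ler_wpM2r ?exprn_ge0 ?normc_ge0.
  apply: abs_has_sum (sums_le_prod _ _ _).
  - by move=> p; exact: normc_ge0.
  - move=> m; apply: sums_le_le (_ : sums_le (fun n => normc (A m) *
      (2 * n.+1%:R ^- 2)) _) => [n|].
      rewrite [X (m, n)]/X normcM ler_wpM2l ?normc_ge0 //.
      exact: (normc_Rm_term_le _ _ _ _ _ hk).
    apply: sums_leZ; first exact: normc_ge0.
    exact: sums_leZ (@sums_le_inv_sqr R).
  - apply: sums_le_le (sums_leZ _ (sums_le_binomial k.-1 q1)) => [m|].
      by have := A_le m; rewrite -natrM; apply.
    by rewrite mulr_ge0.
have zT : has_sum (fun n : nat => y n.+1%:Z + y (- n.+1%:Z)) T.
  pose sw (p : nat * nat) := (p.2, p.1).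
  have swK : cancel sw sw by case.
  apply: has_sum_fubini (_ : has_sum (X \o sw) T) row_z.
  by apply/(has_sum_bij _ _ swK swK).
have qT : has_sum (qexp_term l k i h tau) T.
  apply: has_sum_fubini XT _ => m.
  have -> : qexp_term l k i h tau m = A m * usum (Rm_term l k i h m).
    rewrite /qexp_term /extend0 /Rm /A; case: m => [|m] /=; last by ring.
    by rewrite expr0n eqn0Ngt K0 mulr0 !mul0r.
  apply: (@has_sumZ R nat (fun n => Rm_term l k i h m n.+1) _ (A m)).
  exact/(has_sum_succ (x := Rm_term l k i h m)).
split.
- exact: has_sum_usummable xE.
- exact: has_sum_usummable R0y.
- by move=> m _; exact: has_sum_usummable (Rm_has m).
- exact: has_sum_usummable qT.
- rewrite /twisted_eisenstein /R0 (has_sum_usum xE) (has_sum_usum R0y).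
  by rewrite (has_sum_usum qT) -(has_sum_unique zE zT) addrC subrK.
Qed.
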